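(* Let $U$ be an optimal machine. There exists some $\varepsilon>0$ such that no randomized algorithm computes, with positive probability, a function $\alpha$ with $\overline{E}(\alpha,\mathrm{dom}(U))<\varepsilon$.
   Context: A machine is a partial computable function from binary strings to binary strings; for a machine $V$ let $C_V(x)=\min\{|p|\colon V(p)=x\}$ (plain Kolmogorov complexity with respect to $V$). $U$ is optimal if for every machine $V$ there is $c$ with $C_U(x)\le C_V(x)+c$ for all $x$. For a set $A$ of strings and a function $\alpha$ on strings, $\varepsilon_n$ is the fraction of strings of length at most $n$ where $\alpha$ and the characteristic function of $A$ differ (points where $\alpha$ is undefined count as errors), and $\overline{E}(\alpha,A)=\limsup_n\varepsilon_n$. A randomized algorithm is an oracle machine run with a uniformly random oracle (independent fair coin tosses). *)

(* Defs.v *)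
From Stdlib Require Import Reals List Arith ClassicalEpsilon.
From Coquelicot Require Import Coquelicot.
Import ListNotations.
Open Scope R_scope.

Definition str := list bool.

(* Bijective encoding of binary strings into nat (bijective base-2 numeration). *)
Fixpoint enc (w : str) : nat :=
  match w with
  | nil => 0%nat
  | b :: w' => (2 * enc w' + (if b then 2 else 1))%nat
  end.

(* Arguments are passed as a list; missing arguments default to 0.
   [Orc] queries the oracle X at its first argument (answer 1/0). *)
Inductive prf : Type :=
| Zero : prf
| Succ : prf
| Proj : nat -> prf
| Orc  : prf
| Comp : prf -> list prf -> prf
| Prim : prf -> prf -> prf
| Mu   : prf -> prf.

(* Fuel-indexed evaluator (monotone in the fuel). *)
Fixpoint eval (k : nat) (X : nat -> bool) (e : prf) (v : list nat) {struct k}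
  : option nat :=
  match k with
  | O => None
  | S k =>
    match e with
    | Zero => Some 0%nat
    | Succ => Some (S (nth 0 v 0%nat))
    | Proj i => Some (nth i v 0%nat)
    | Orc => Some (if X (nth 0 v 0%nat) then 1%nat else 0%nat)
    | Comp f gs =>
        match (fix evs (gs : list prf) : option (list nat) :=
                 match gs with
                 | nil => Some nil
                 | g :: gs' =>
                     match eval k X g v, evs gs' with
                     | Some a, Some w => Some (a :: w)
                     | _, _ => None
                     end
                 end) gs with
        | Some w => eval k X f w
        | None => None
        end
    | Prim f g =>
        (fix pr (n : nat) : option nat :=
           match n with
           | O => eval k X f (tl v)
           | S n' => match pr n' with
                     | Some r => eval k X g (n' :: r :: tl v)
                     | None => None
                     end
           end) (hd 0%nat v)
    | Mu f =>
        (fix mu (n y : nat) : option nat :=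
           match n with
           | O => None
           | S n' => match eval k X f (y :: v) with
                     | Some O => Some y
                     | Some _ => mu n' (S y)
                     | None => None
                     end
           end) k 0%nat
    end
  end.

Definition ocomp (e : prf) (X : nat -> bool) (v : list nat) (m : nat) : Prop :=
  exists k, eval k X e v = Some m.

(* A machine is given by a code; V(p) = x iff the code halts on enc p with output enc x.
   (No oracle: the constant-false oracle is used.) *)
Definition machine := prf.
Definition runs (V : machine) (p x : str) : Prop :=
  ocomp V (fun _ => false) [enc p] (enc x).

Definition is_C (V : machine) (x : str) (k : nat) : Prop :=
  (exists p, runs V p x /\ length p = k) /\
  (forall p, runs V p x -> (k <= length p)%nat).

(* U is optimal: for every V there is c with C_U(x) <= C_V(x) + c for all x
   (whenever C_V(x) is defined, i.e. finite; otherwise the inequality is trivial). *)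
Definition optimal (U : machine) : Prop :=
  forall V : machine, exists c : nat, forall x kV, is_C V x kV ->
    exists kU, is_C U x kU /\ (kU <= kV + c)%nat.

Definition dom (U : machine) (p : str) : Prop := exists x, runs U p x.

Fixpoint strs_len (n : nat) : list str :=
  match n with
  | O => [nil]
  | S n' => map (cons false) (strs_len n') ++ map (cons true) (strs_len n')
  end.

Definition strs_upto (n : nat) : list str := flat_map strs_len (seq 0 (S n)).

Definition err (alpha : str -> option bool) (A : str -> Prop) (x : str) : Prop :=
  ~ (alpha x = Some true /\ A x \/ alpha x = Some false /\ ~ A x).

Definition count_P {T} (P : T -> Prop) (l : list T) : nat :=
  length (filter (fun x => if excluded_middle_informative (P x) then true else false) l).

Definition eps_n (alpha : str -> option bool) (A : str -> Prop) (n : nat) : R :=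
  INR (count_P (err alpha A) (strs_upto n)) / INR (length (strs_upto n)).

Definition Ebar (alpha : str -> option bool) (A : str -> Prop) : Rbar :=
  LimSup_seq (eps_n alpha A).

Definition ocomputes (Phi : prf) (X : nat -> bool) (alpha : str -> option bool) : Prop :=
  forall x, (alpha x = None <-> ~ exists m, ocomp Phi X [enc x] m) /\
            (forall m, ocomp Phi X [enc x] m -> alpha x = Some (negb (Nat.eqb m 0))).

(* Uniform (fair coin) measure on Cantor space: null sets via cylinder covers. *)
Definition prefix (w : str) (X : nat -> bool) : Prop :=
  forall j, (j < length w)%nat -> nth j w false = X j.

Definition null (S : (nat -> bool) -> Prop) : Prop :=
  forall d : R, 0 < d -> exists w : nat -> str,
    (forall X, S X -> exists i, prefix (w i) X) /\
    (forall n, sum_f_R0 (fun i => (/2) ^ length (w i)) n <= d).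

(* For the (Borel) events considered, positive probability = not null. *)
Definition pos_prob (S : (nat -> bool) -> Prop) : Prop := ~ null S.

(* Main.v *)
Require Import Defs.
From Stdlib Require Import Reals.
From Coquelicot Require Import Coquelicot.
From Stdlib Require Import List Arith Lia Lra Classical ClassicalEpsilon.
From Stdlib Require Import FunctionalExtensionality Cantor.
Import ListNotations.

(** One obstacle is a circularity: [c] comes from comparing [U] with the search machine [V], yet the
    search must know [c], since errors are counted up to length [L + c]. So [c] too is read off the
    program length; [V] then depends on [U] alone, and [eps] can be fixed right after [c].

    Probability is replaced by outer measure through covers by cylinders, so no event has to be
    shown measurable. The threshold of one half is used twice, inside a cylinder where the accurate
    oracles cannot be covered at half its weight. If agreeing oracles never formed a majority, their
    union over all late stages, an increasing one, would be a half-price cover. If at the chosen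
    stage no agreeing oracle were accurate, the remaining minority would be one. *)

(** Suppose that, with positive probability, [Phi] errs on a fraction below [eps]
    of the strings of length at most [n], for all large [n]; by Lebesgue density this
    has conditional probability above 1/2 in some cylinder. Given [n] and the
    cylinder, one finds a stage [t] at which more than half of the oracles make
    [Phi] agree, up to [eps], with the programs of [U] that have halted by then. Some
    oracle has few errors both at stage [t] and in the limit, so only [O(eps * 2^n)]
    programs of length at most [n] halt after stage [t]. But the [2^(n-c)] strings
    computed from [t] and a string of length [n-c] are not outputs of programs that
    have halted by stage [t], and by optimality each of them needs a program of length
    at most [n] that halts later. The constants do not depend on [Phi] and the
    cylinder because these are encoded in the length [n-c] itself. *)

Local Open Scope nat_scope.

(** * Evaluation *)

(** [evs], [primrec] and [musearch] name the anonymous fixpoints inside [eval], up to conversion, so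
    that each can have its own induction. *)
Definition evs (h : prf -> option nat) :=
  fix evs (gs : list prf) : option (list nat) :=
    match gs with
    | nil => Some nil
    | g :: gs' =>
        match h g, evs gs' with
        | Some a, Some w => Some (a :: w)
        | _, _ => None
        end
    end.

Definition primrec (b : option nat) (h : nat -> nat -> option nat) :=
  fix pr (n : nat) : option nat :=
    match n with
    | O => b
    | S n' => match pr n' with Some r => h n' r | None => None end
    end.

Definition musearch (h : nat -> option nat) :=
  fix mu (n y : nat) : option nat :=
    match n with
    | O => None
    | S n' => match h y with
              | Some O => Some y
              | Some _ => mu n' (S y)
              | None => None
              end
    end.

Lemma eval_Comp k X f gs v :
  eval (S k) X (Comp f gs) v =
  match evs (fun g => eval k X g v) gs with
  | Some w => eval k X f w
  | None => None
  end.
Proof. reflexivity. Qed.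

Lemma eval_Prim k X f g v :
  eval (S k) X (Prim f g) v =
  primrec (eval k X f (tl v)) (fun n r => eval k X g (n :: r :: tl v)) (hd 0 v).
Proof. reflexivity. Qed.

Lemma eval_Mu k X f v :
  eval (S k) X (Mu f) v = musearch (fun y => eval k X f (y :: v)) k 0.
Proof. reflexivity. Qed.

Lemma evs_mono (h h' : prf -> option nat) gs w :
  (forall g a, h g = Some a -> h' g = Some a) ->
  evs h gs = Some w -> evs h' gs = Some w.
Proof.
  intros H. revert w. induction gs as [|g gs IH]; simpl; intros w E; auto.
  destruct (h g) eqn:Eg; [|discriminate].
  destruct (evs h gs) eqn:Es; [|discriminate].
  rewrite (H _ _ Eg), (IH _ eq_refl). exact E.
Qed.

Lemma primrec_mono b b' (h h' : nat -> nat -> option nat) n m :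
  (forall a, b = Some a -> b' = Some a) ->
  (forall i r a, h i r = Some a -> h' i r = Some a) ->
  primrec b h n = Some m -> primrec b' h' n = Some m.
Proof.
  intros Hb Hh. revert m. induction n as [|n IH]; simpl; intros m E; auto.
  destruct (primrec b h n) eqn:En; [|discriminate].
  rewrite (IH _ eq_refl). auto.
Qed.

Lemma musearch_mono (h h' : nat -> option nat) n n' y m :
  (forall i a, h i = Some a -> h' i = Some a) -> n <= n' ->
  musearch h n y = Some m -> musearch h' n' y = Some m.
Proof.
  intros H. revert n' y. induction n as [|n IH]; intros n' y Hn E; [discriminate|].
  destruct n' as [|n']; [lia|]. simpl in *.
  destruct (h y) as [[|r]|] eqn:Ey; try discriminate; rewrite (H _ _ Ey); auto.
  apply IH; auto; lia.
Qed.

Lemma eval_mono k k' X e v m :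
  k <= k' -> eval k X e v = Some m -> eval k' X e v = Some m.
Proof.
  revert k' e v m. induction k as [|k IH]; intros k' e v m Hk E; [discriminate|].
  destruct k' as [|k']; [lia|]. assert (Hk' : k <= k') by lia.
  destruct e as [| |i| |f gs|f g|f]; try exact E.
  - rewrite eval_Comp in *.
    destruct (evs (fun g => eval k X g v) gs) as [w|] eqn:Es; [|discriminate].
    rewrite (evs_mono _ (fun g => eval k' X g v) _ w) with (2 := Es); eauto.
  - rewrite eval_Prim in *.
    eapply primrec_mono with (3 := E); simpl; eauto.
  - rewrite eval_Mu in *.
    eapply musearch_mono with (3 := E); simpl; eauto.
Qed.

Lemma ocomp_fun e X v m m' : ocomp e X v m -> ocomp e X v m' -> m = m'.
Proof.
  intros [k H] [k' H'].
  apply (eval_mono _ (k + k')) in H; [|lia].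
  apply (eval_mono _ (k + k')) in H'; [|lia]. congruence.
Qed.

Lemma ocomp_Comp X f gs v w m :
  Forall2 (fun g a => ocomp g X v a) gs w -> ocomp f X w m ->
  ocomp (Comp f gs) X v m.
Proof.
  intros Hgs [k Hk].
  assert (exists k', evs (fun g => eval k' X g v) gs = Some w) as [k' Hk'].
  { clear Hk. induction Hgs as [|g a gs w [k1 H1] _ [k2 H2]]; [now exists 0|].
    exists (k1 + k2). simpl.
    rewrite (eval_mono k1 (k1 + k2) X g v a (Nat.le_add_r _ _) H1).
    rewrite (evs_mono _ (fun g => eval (k1 + k2) X g v) _ w) with (2 := H2); auto.
    intros g' a'. apply eval_mono; lia. }
  exists (S (k + k')). rewrite eval_Comp.
  rewrite (evs_mono _ (fun g => eval (k + k') X g v) _ w) with (2 := Hk').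
  - eapply eval_mono with (2 := Hk); lia.
  - intros g' a'. apply eval_mono; lia.
Qed.

Lemma ocomp_Prim_O X f g v m :
  hd 0 v = 0 -> ocomp f X (tl v) m -> ocomp (Prim f g) X v m.
Proof.
  intros Hv [k Hk]. exists (S k). rewrite eval_Prim, Hv. exact Hk.
Qed.

Lemma ocomp_Prim_S X f g v n r m :
  hd 0 v = S n -> ocomp (Prim f g) X (n :: tl v) r ->
  ocomp g X (n :: r :: tl v) m -> ocomp (Prim f g) X v m.
Proof.
  intros Hv [k Hk] [k' Hk']. destruct k as [|k]; [discriminate|].
  exists (S (k + k')). rewrite eval_Prim in *. rewrite Hv. simpl in *.
  rewrite (primrec_mono _ (eval (k + k') X f (tl v)) _
    (fun i r => eval (k + k') X g (i :: r :: tl v)) n r) with (3 := Hk).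
  - apply eval_mono with (2 := Hk'); lia.
  - intros a. apply eval_mono; lia.
  - intros i s a. apply eval_mono; lia.
Qed.

Lemma ocomp_Mu X f v m :
  (forall y, y < m -> exists r, ocomp f X (y :: v) (S r)) ->
  ocomp f X (m :: v) 0 -> ocomp (Mu f) X v m.
Proof.
  intros Hlt [k0 H0].
  (* Induction on the distance [j] to [m], because [musearch] runs upward from its starting
     point. *)
  assert (forall j, j <= m -> exists k n,
    musearch (fun y => eval k X f (y :: v)) n (m - j) = Some m) as H.
  { induction j as [|j IH]; intros Hj.
    - exists k0, 1. simpl. rewrite Nat.sub_0_r, H0. reflexivity.
    - destruct IH as (k & n & IH); [lia|].
      destruct (Hlt (m - S j)) as (r & k' & Hr); [lia|].
      exists (k + k'), (S n). simpl.
      rewrite (eval_mono k' (k + k') X f _ _ (Nat.le_add_l _ _) Hr).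
      replace (S (m - S j)) with (m - j) by lia.
      eapply musearch_mono with (3 := IH); [|lia].
      intros i a. apply eval_mono; lia. }
  destruct (H m) as (k & n & Hm); [lia|]. rewrite Nat.sub_diag in Hm.
  exists (S (k + n)). rewrite eval_Mu.
  eapply musearch_mono with (3 := Hm); [|lia].
  intros i a. apply eval_mono; lia.
Qed.

(** * Computable functions and decidable predicates *)

Definition env (v : list nat) : nat -> nat := fun i => nth i v 0.

(* [s i] is the de Bruijn variable [i]; the arity [m] is fixed so that a recursion
   can pass its whole environment on as parameters. *)
Definition cf (m : nat) (f : (nat -> nat) -> nat) : Prop :=
  exists e, forall X v, length v = m -> ocomp e X v (f (env v)).

(** Truth is the value 0 because that is where [Mu] stops. *)
Definition decid (m : nat) (P : (nat -> nat) -> Prop) : Prop :=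
  exists f, cf m f /\ forall s, f s = 0 <-> P s.

Lemma cf_ext m f g : (forall s, f s = g s) -> cf m f -> cf m g.
Proof.
  intros H [e He]. exists e. intros X v Hv. rewrite <- H. auto.
Qed.

Lemma decid_ext m P Q : (forall s, P s <-> Q s) -> decid m P -> decid m Q.
Proof.
  intros H (f & Hf & HP). exists f. split; auto. intros s. rewrite HP. auto.
Qed.

Lemma cf_var m i : cf m (fun s => s i).
Proof. exists (Proj i). intros X v _. now exists 1. Qed.

Lemma cf_comp1 m f a : cf 1 (fun s => f (s 0)) -> cf m a -> cf m (fun s => f (a s)).
Proof.
  intros [ef Hf] [ea Ha]. exists (Comp ef [ea]). intros X v Hv.
  eapply ocomp_Comp; [repeat constructor; auto|].
  apply (Hf X [_] eq_refl).
Qed.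

Lemma cf_S m a : cf m a -> cf m (fun s => S (a s)).
Proof.
  apply cf_comp1. exists Succ. intros X v _. now exists 1.
Qed.

Lemma cf_const m k : cf m (fun _ => k).
Proof.
  induction k as [|k IH].
  - exists Zero. intros X v _. now exists 1.
  - exact (cf_S _ _ IH).
Qed.

Lemma Forall2_Proj X v : forall u w, v = w ++ u ->
  Forall2 (fun g a => ocomp g X v a) (map Proj (seq (length w) (length u))) u.
Proof.
  induction u as [|a u IH]; simpl; intros w E; constructor.
  - exists 1. simpl. rewrite E, app_nth2, Nat.sub_diag; auto.
  - replace (S (length w)) with (length (w ++ [a])) by (rewrite length_app; simpl; lia).
    apply IH. rewrite <- app_assoc. exact E.
Qed.

Lemma cf_rec m a b g :
  cf m b -> cf m a -> cf (S (S m)) (fun s => g (s 0) (s 1) (fun i => s (S (S i)))) ->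
  cf m (fun s => nat_rect (fun _ => nat) (b s) (fun n r => g n r s) (a s)).
Proof.
  intros [eb Hb] [ea Ha] [eg Hg].
  (* [Prim] takes its bound from the head and hands the tail to both functions, so the bound is
     prepended to a full copy of the environment. *)
  exists (Comp (Prim eb eg) (ea :: map Proj (seq 0 m))). intros X v Hv.
  eapply ocomp_Comp with (w := a (env v) :: v).
  - constructor; auto. subst m. now apply (Forall2_Proj X v v []).
  - generalize (a (env v)) as n. induction n as [|n IH].
    + now apply ocomp_Prim_O; simpl; auto.
    + eapply ocomp_Prim_S; [reflexivity|exact IH|].
      apply (Hg X (n :: _ :: v)). simpl. now rewrite Hv.
Qed.

Lemma cf_pred m a : cf m a -> cf m (fun s => Nat.pred (a s)).
Proof.
  apply cf_comp1.
  apply cf_ext with (fun s => nat_rect (fun _ => nat) 0 (fun n r => n) (s 0)).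
  - intros s. now destruct (s 0).
  - apply cf_rec; auto using cf_var, cf_const.
Qed.

Lemma cf_add m a b : cf m a -> cf m b -> cf m (fun s => a s + b s).
Proof.
  intros Ha Hb.
  apply cf_ext with (fun s => nat_rect (fun _ => nat) (b s) (fun n r => S r) (a s)).
  - intros s. induction (a s); simpl; auto.
  - apply cf_rec; auto. apply cf_S, (cf_var _ 1).
Qed.

(** Weakening under [k] new binders. *)
Lemma cf_shift m k f : cf m f -> cf (k + m) (fun s => f (fun i => s (k + i))).
Proof.
  intros [e He].
  exists (Comp e (map Proj (seq k m))). intros X v Hv.
  eapply ocomp_Comp with (w := skipn k v).
  - pose proof (Forall2_Proj X v (skipn k v) (firstn k v)) as H.
    rewrite firstn_skipn, length_firstn, length_skipn, Hv in H.
    replace (Nat.min k (k + m)) with k in H by lia.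
    replace (k + m - k) with m in H by lia. auto.
  - replace (fun i => env v (k + i)) with (env (skipn k v)).
    + apply He. rewrite length_skipn. lia.
    + apply functional_extensionality. intros i.
      apply nth_skipn.
Qed.

Lemma cf_sub m a b : cf m a -> cf m b -> cf m (fun s => a s - b s).
Proof.
  intros Ha Hb.
  apply cf_ext with (fun s => nat_rect (fun _ => nat) (a s) (fun n r => Nat.pred r) (b s)).
  - intros s. induction (b s); simpl; lia.
  - apply cf_rec; auto. apply cf_pred, (cf_var _ 1).
Qed.

Lemma cf_mul m a b : cf m a -> cf m b -> cf m (fun s => a s * b s).
Proof.
  intros Ha Hb.
  apply cf_ext with (fun s => nat_rect (fun _ => nat) 0 (fun n r => b s + r) (a s)).
  - intros s. induction (a s); simpl; auto.
  - apply (cf_rec m a (fun _ => 0) (fun n r s => b s + r)); auto using cf_const.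
    apply cf_add; [apply (cf_shift m 2 b Hb)|apply (cf_var _ 1)].
Qed.

Lemma cf_pow2 m a : cf m a -> cf m (fun s => 2 ^ a s).
Proof.
  intros Ha.
  apply cf_ext with (fun s => nat_rect (fun _ => nat) 1 (fun n r => r + r) (a s)).
  - intros s. induction (a s) as [|n IH]; simpl in *; lia.
  - apply cf_rec; auto using cf_const. apply cf_add; apply (cf_var _ 1).
Qed.

Lemma decid_le m a b : cf m a -> cf m b -> decid m (fun s => a s <= b s).
Proof.
  intros Ha Hb. exists (fun s => a s - b s). split; [now apply cf_sub|intros s; lia].
Qed.

Lemma decid_lt m a b : cf m a -> cf m b -> decid m (fun s => a s < b s).
Proof. intros Ha. apply decid_le. now apply cf_S. Qed.

Lemma decid_eq m a b : cf m a -> cf m b -> decid m (fun s => a s = b s).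
Proof.
  intros Ha Hb. exists (fun s => (a s - b s) + (b s - a s)).
  split; [auto using cf_add, cf_sub|intros s; lia].
Qed.

Lemma decid_and m P Q : decid m P -> decid m Q -> decid m (fun s => P s /\ Q s).
Proof.
  intros (f & Hf & HP) (g & Hg & HQ). exists (fun s => f s + g s).
  split; [now apply cf_add|]. intros s. rewrite <- HP, <- HQ. lia.
Qed.

Lemma decid_or m P Q : decid m P -> decid m Q -> decid m (fun s => P s \/ Q s).
Proof.
  intros (f & Hf & HP) (g & Hg & HQ). exists (fun s => f s * g s).
  split; [now apply cf_mul|]. intros s. rewrite <- HP, <- HQ. nia.
Qed.

Lemma decid_not m P : decid m P -> decid m (fun s => ~ P s).
Proof.
  intros (f & Hf & HP). exists (fun s => 1 - f s).
  split; [auto using cf_sub, cf_const|]. intros s. rewrite <- HP. lia.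
Qed.

Lemma decid_imp m P Q : decid m P -> decid m Q -> decid m (fun s => P s -> Q s).
Proof.
  intros HP HQ. apply decid_ext with (fun s => ~ P s \/ Q s).
  - intros s. tauto.
  - now apply decid_or; [apply decid_not|].
Qed.

(** * Bounded counting and bounded quantifiers *)

Definition cnt (P : nat -> Prop) (n : nat) : nat := count_P P (seq 0 n).

Lemma cnt_S P n :
  cnt P (S n) = cnt P n + (if excluded_middle_informative (P n) then 1 else 0).
Proof.
  unfold cnt, count_P. rewrite seq_S, filter_app, length_app. simpl.
  destruct (excluded_middle_informative (P n)); reflexivity.
Qed.

Lemma cnt_pos P n : 0 < cnt P n <-> exists i, i < n /\ P i.
Proof.
  induction n as [|n IH].
  - split; [intros H; inversion H|intros (i & Hi & _); lia].
  - rewrite cnt_S. destruct (excluded_middle_informative (P n)) as [p|p].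
    + split; [intros _; exists n; auto|intros _; lia].
    + rewrite Nat.add_0_r, IH. split; intros (i & Hi & Pi); exists i; split; auto.
      assert (i <> n) by congruence. lia.
Qed.

(** This one recursion yields both bounded quantifiers as well as the counts of errors and of
    oracles in the search. *)
Lemma cf_cnt m P b :
  cf m b -> decid (S m) (fun s => P (s 0) (fun i => s (S i))) ->
  cf m (fun s => cnt (fun i => P i s) (b s)).
Proof.
  intros Hb (f & [e He] & HP).
  apply cf_ext with (fun s => nat_rect (fun _ => nat) 0
    (fun n r => r + (1 - f (fun i => match i with O => n | S i => s i end))) (b s)).
  - intros s. induction (b s) as [|n IH]; [reflexivity|]. rewrite cnt_S, <- IH.
    cbn [nat_rect]. f_equal. pose proof (HP (fun i => match i with O => n | S i => s i end)) as H.
    cbn in H. destruct (excluded_middle_informative (P n s)) as [p|p].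
    + apply H in p. lia.
    + assert (f (fun i => match i with O => n | S i => s i end) <> 0) by tauto. lia.
  - apply (cf_rec m b (fun _ => 0) (fun n r s =>
      r + (1 - f (fun i => match i with O => n | S i => s i end)))); auto using cf_const.
    apply cf_add; [apply cf_var|]. apply cf_sub; [apply cf_const|].
    (* The accumulator at position 1 is skipped: [P] sees only the index and the old environment. *)
    exists (Comp e (Proj 0 :: map Proj (seq 2 m))). intros X v Hv.
    destruct v as [|n [|r v]]; try discriminate. injection Hv as Hv.
    eapply ocomp_Comp with (w := n :: v).
    + constructor; [now exists 1|].
      pose proof (Forall2_Proj X (n :: r :: v) v [n; r] eq_refl) as H.
      simpl in H. now rewrite Hv in H.
    + replace (fun i => match i with O => env (n :: r :: v) 0
               | S i => env (n :: r :: v) (S (S i)) end) with (env (n :: v)).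
      * apply He. simpl; now rewrite Hv.
      * apply functional_extensionality. now intros [|i].
Qed.

Lemma decid_ex m P b :
  cf m b -> decid (S m) (fun s => P (s 0) (fun i => s (S i))) ->
  decid m (fun s => exists i, i < b s /\ P i s).
Proof.
  intros Hb HP. apply decid_ext with (fun s => 1 <= cnt (fun i => P i s) (b s)).
  - intros s. apply cnt_pos.
  - apply decid_le; [apply cf_const|now apply cf_cnt].
Qed.

Lemma decid_all m P b :
  cf m b -> decid (S m) (fun s => P (s 0) (fun i => s (S i))) ->
  decid m (fun s => forall i, i < b s -> P i s).
Proof.
  intros Hb HP. apply decid_ext with (fun s => ~ exists i, i < b s /\ ~ P i s).
  - intros s. split.
    + intros H i Hi. apply NNPP. intros Hn. apply H. eauto.
    + intros H (i & Hi & Hn). auto.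
  - apply decid_not, (decid_ex m (fun i s => ~ P i s)); auto.
    now apply (decid_not (S m) (fun s => P (s 0) (fun i => s (S i)))).
Qed.

(** Expresses a binary digit by bounded quantifiers and arithmetic, so that no division has to be
    programmed. *)
Lemma testbit_ex a n :
  Nat.testbit a n = true <->
  exists q, q < S a /\ exists r, r < 2 ^ n /\ a = 2 ^ n * (2 * q + 1) + r.
Proof.
  assert (Hp : 2 ^ n <> 0) by (apply Nat.pow_nonzero; lia).
  rewrite Nat.testbit_true. split.
  - intros H. exists (a / 2 ^ n / 2). split.
    { assert (a / 2 ^ n <= a) by (apply Nat.Div0.div_le_upper_bound; nia).
      assert (a / 2 ^ n / 2 <= a / 2 ^ n) by (apply Nat.Div0.div_le_upper_bound; nia).
      lia. }
    exists (a mod 2 ^ n). split; [now apply Nat.mod_upper_bound|].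
    pose proof (Nat.div_mod_eq a (2 ^ n)) as H1.
    pose proof (Nat.div_mod_eq (a / 2 ^ n) 2) as H2.
    rewrite H in H2. rewrite <- H2. exact H1.
  - intros (q & _ & r & Hr & E).
    rewrite <- (Nat.div_unique a (2 ^ n) (2 * q + 1) r) by lia.
    symmetry. apply (Nat.mod_unique _ 2 q); lia.
Qed.

Lemma decid_testbit m a b :
  cf m a -> cf m b -> decid m (fun s => Nat.testbit (a s) (b s) = true).
Proof.
  intros Ha Hb.
  apply decid_ext with (1 := fun s => iff_sym (testbit_ex (a s) (b s))).
  apply (decid_ex m (fun q s => exists r, r < 2 ^ b s /\ a s = 2 ^ b s * (2 * q + 1) + r));
    [now apply cf_S|].
  pose proof (cf_shift m 1 a Ha) as Ha1. pose proof (cf_shift m 1 b Hb) as Hb1.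
  pose proof (cf_shift m 2 a Ha) as Ha2. pose proof (cf_shift m 2 b Hb) as Hb2.
  apply (decid_ex (S m) (fun r s =>
    a (fun i => s (S i)) = 2 ^ b (fun i => s (S i)) * (2 * s 0 + 1) + r)); [now apply cf_pow2|].
  repeat first [apply decid_eq|apply cf_add|apply cf_mul|apply cf_pow2|apply cf_const
    |exact Ha2|exact Hb2|apply cf_var].
Qed.

(** * Certificates of computations *)

(** Injective because the value lies between [(a + b)^2] and [(a + b + 1)^2], which determines
    [a + b]. Pairs are decoded by bounded search, which [pr_le_l] and [pr_le_r] make possible. *)
Definition pr (a b : nat) : nat := (a + b) * (a + b) + b.

Lemma pr_inj a b a' b' : pr a b = pr a' b' -> a = a' /\ b = b'.
Proof.
  unfold pr. intros H.
  assert (a + b = a' + b') by (destruct (Nat.lt_trichotomy (a + b) (a' + b')) as [|[|]]; nia).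
  nia.
Qed.

Lemma pr_le_l a b : a <= pr a b.
Proof. unfold pr. nia. Qed.

Lemma pr_le_r a b : b <= pr a b.
Proof. unfold pr. nia. Qed.

Lemma cf_pr m a b : cf m a -> cf m b -> cf m (fun s => pr (a s) (b s)).
Proof. unfold pr. auto using cf_add, cf_mul. Qed.

Opaque pr.

(** The successor separates nonempty lists from the empty one, as [pr 0 0] is 0. *)
Definition lcode (v : list nat) : nat := fold_right (fun a l => S (pr a l)) 0 v.

Fixpoint code (e : prf) : nat :=
  match e with
  | Zero => pr 0 0
  | Succ => pr 1 0
  | Proj i => pr 2 i
  | Orc => pr 3 0
  | Comp f gs => pr 4 (pr (code f) (lcode (map code gs)))
  | Prim f g => pr 5 (pr (code f) (code g))
  | Mu f => pr 6 (code f)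
  end.

Definition atom (e v m : nat) : nat := pr e (pr v m).

(* An atom asserts "[e] on the argument list [v] has value [m]"; a certificate [c] is
   a finite set of atoms, given by its binary digits. That every atom of [c] follows
   from others by one evaluation rule is a condition with quantifiers bounded by [c],
   so searching for certificates replaces a universal machine. *)
Definition mem (c e v m : nat) : Prop := Nat.testbit c (atom e v m) = true.

(** The empty list has head 0 and an empty tail, matching the default for missing arguments in
    [eval]. *)
Definition uncons (v a u : nat) : Prop :=
  v = 0 /\ a = 0 /\ u = 0 \/ v = S (pr a u).

(* Besides the codes of [prf], tag 7 evaluates a list of functions to the list of
   their values, and tag 8 continues the search of [Mu] from the first argument. *)
Definition step (c : nat) (X : nat -> bool) (e v m a u p q r w : nat) : Prop :=
  e = pr 0 0 /\ m = 0
  \/ e = pr 1 0 /\ m = S a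
  \/ e = pr 2 0 /\ m = a
  \/ e = pr 2 (S p) /\ mem c (pr 2 p) u m
  \/ e = pr 3 0 /\ (X a = true /\ m = 1 \/ X a <> true /\ m = 0)
  \/ e = pr 4 (pr p q) /\ mem c (pr 7 q) v r /\ mem c p r m
  \/ e = pr 7 0 /\ m = 0
  \/ e = pr 7 (S (pr p q)) /\ m = S (pr r w) /\ mem c p v r /\ mem c (pr 7 q) v w
  \/ e = pr 5 (pr p q) /\ a = 0 /\ mem c p u m
  \/ e = pr 5 (pr p q) /\ a = S w /\ mem c e (S (pr w u)) r
       /\ mem c q (S (pr w (S (pr r u)))) m
  \/ e = pr 6 p /\ mem c (pr 8 p) (S (pr 0 v)) m
  \/ e = pr 8 p /\ mem c p v 0 /\ m = a
  \/ e = pr 8 p /\ mem c p v (S r) /\ mem c (pr 8 p) (S (pr (S a) u)) m.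

Definition justified (c : nat) (X : nat -> bool) (e v m : nat) : Prop :=
  exists a, a < c /\ exists u, u < c /\ uncons v a u /\
  exists p, p < c /\ exists q, q < c /\ exists r, r < c /\ exists w, w < c /\
  step c X e v m a u p q r w.

Definition valid (c : nat) (X : nat -> bool) : Prop :=
  forall e, e < c -> forall v, v < c -> forall m, m < c ->
  mem c e v m -> justified c X e v m.

Definition prov (X : nat -> bool) (e v m : nat) : Prop :=
  exists c, valid c X /\ mem c e v m.

Ltac solve_decid :=
  repeat (cbv beta; first
    [ apply cf_const | apply cf_var | apply cf_S | apply cf_pr | apply cf_add
    | apply cf_mul | apply cf_pow2 | apply decid_testbit | apply decid_eq | apply decid_lt
    | apply decid_le | apply decid_and | apply decid_or | apply decid_not | apply decid_ex
    | apply decid_all | apply decid_imp | apply cf_cnt ]).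

(** * Completeness and soundness of certificates *)

Lemma testbit_lt c x : Nat.testbit c x = true -> x < c.
Proof.
  intros H. destruct (Nat.eq_dec c 0) as [->|Hc]; [now rewrite Nat.bits_0 in H|].
  pose proof (Nat.log2_lt_lin c). destruct (Nat.le_gt_cases x (Nat.log2 c)); [lia|].
  rewrite Nat.bits_above_log2 in H; [discriminate|lia].
Qed.

Lemma mem_lt c e v m : mem c e v m -> e < c /\ v < c /\ m < c.
Proof.
  intros H%testbit_lt. unfold atom in H.
  pose proof (pr_le_l e (pr v m)). pose proof (pr_le_r e (pr v m)).
  pose proof (pr_le_l v m). pose proof (pr_le_r v m). lia.
Qed.

(** Inclusion of finite sets implies the order of their codes, so witnesses bounded by a certificate
    stay bounded when it grows. *)
Lemma le_of_testbit c c' :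
  (forall x, Nat.testbit c x = true -> Nat.testbit c' x = true) -> c <= c'.
Proof.
  intros H. replace c with (Nat.land c' c); [apply Nat.land_le_l|].
  apply Nat.bits_inj. intros x. rewrite Nat.land_spec.
  destruct (Nat.testbit c x) eqn:E; [|apply Bool.andb_false_r].
  now rewrite (H _ E).
Qed.

Lemma step_mono c c' X e v m a u p q r w :
  (forall x, Nat.testbit c x = true -> Nat.testbit c' x = true) ->
  step c X e v m a u p q r w -> step c' X e v m a u p q r w.
Proof.
  intros H. assert (forall e v m, mem c e v m -> mem c' e v m) by (unfold mem; auto).
  unfold step. intuition auto 15.
Qed.

Lemma justified_mono c c' X e v m :
  (forall x, Nat.testbit c x = true -> Nat.testbit c' x = true) ->
  justified c X e v m -> justified c' X e v m.
Proof.
  intros H (a & Ha & u & Hu & Hv & p & Hp & q & Hq & r & Hr & w & Hw & Hs).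
  pose proof (le_of_testbit _ _ H).
  exists a; split; [lia|]. exists u; split; [lia|]. split; auto.
  exists p; split; [lia|]. exists q; split; [lia|]. exists r; split; [lia|].
  exists w; split; [lia|]. eapply step_mono; eauto.
Qed.

Lemma valid_lor c c' X : valid c X -> valid c' X -> valid (Nat.lor c c') X.
Proof.
  intros H H' e _ v _ m _ Hm. unfold mem in Hm. rewrite Nat.lor_spec in Hm.
  apply Bool.orb_true_iff in Hm as [Hm|Hm]; pose proof (mem_lt _ _ _ _ Hm) as (? & ? & ?).
  - apply justified_mono with c; auto. intros x Hx. rewrite Nat.lor_spec, Hx. reflexivity.
  - apply justified_mono with c'; auto. intros x Hx.
    rewrite Nat.lor_spec, Hx. apply Bool.orb_true_r.
Qed.

Lemma prov2 X e v m e' v' m' :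
  prov X e v m -> prov X e' v' m' ->
  exists c, valid c X /\ mem c e v m /\ mem c e' v' m'.
Proof.
  intros (c & Hc & H) (c' & Hc' & H'). exists (Nat.lor c c').
  unfold mem in *. rewrite !Nat.lor_spec, H, H', Bool.orb_true_r.
  auto using valid_lor.
Qed.

(** The new atom is added to [c] by setting its bit. A set bit has a position below the number
    itself, so whatever is at most the code of the atom is below the enlarged certificate; hence the
    two ways to bound each witness. *)
Lemma prov_step X c e v m a u p q r w :
  valid c X -> uncons v a u ->
  (p <= pr e (pr v m) \/ p < c) -> (q <= pr e (pr v m) \/ q < c) ->
  (r <= pr e (pr v m) \/ r < c) -> (w <= pr e (pr v m) \/ w < c) ->
  step c X e v m a u p q r w -> prov X e v m.
Proof.
  intros Hc Hv Hp Hq Hr Hw Hs. set (c' := Nat.setbit c (atom e v m)).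
  assert (Hsub : forall x, Nat.testbit c x = true -> Nat.testbit c' x = true).
  { intros x Hx. unfold c'. rewrite Nat.setbit_iff. auto. }
  assert (Hm : mem c' e v m) by apply Nat.setbit_eq.
  pose proof (testbit_lt _ _ Hm) as Hf. unfold atom in Hf.
  pose proof (le_of_testbit _ _ Hsub).
  assert (Hau : a <= v /\ u <= v).
  { pose proof (pr_le_l a u). pose proof (pr_le_r a u). destruct Hv; lia. }
  destruct (mem_lt _ _ _ _ Hm) as (? & ? & ?).
  exists c'. split; auto. intros e0 _ v0 _ m0 _ Hn.
  unfold mem, c' in Hn. rewrite Nat.setbit_iff in Hn. destruct Hn as [Hn|Hn].
  - apply pr_inj in Hn as [<- Hn]. apply pr_inj in Hn as [<- <-].
    exists a; split; [lia|]. exists u; split; [lia|]. split; auto.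
    exists p; split; [lia|]. exists q; split; [lia|]. exists r; split; [lia|].
    exists w; split; [lia|]. eapply step_mono; eauto.
  - destruct (mem_lt _ _ _ _ Hn) as (? & ? & ?).
    apply justified_mono with c; auto.
Qed.

Lemma uncons_lcode v : uncons (lcode v) (hd 0 v) (lcode (tl v)).
Proof. destruct v as [|a v]; [left|right]; auto. Qed.

Lemma lcode_uncons v a u : uncons (lcode v) a u -> a = hd 0 v /\ u = lcode (tl v).
Proof.
  destruct v as [|b v]; simpl; intros [H|H]; try lia.
  injection H as H. apply pr_inj in H as [<- <-]. auto.
Qed.

Lemma valid_0 X : valid 0 X.
Proof. intros e He. lia. Qed.

Ltac pr_bounds :=
  repeat match goal with
  | |- context [pr ?a ?b] =>
      lazymatch goal with
      | _ : a <= pr a b |- _ => fail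
      | _ => pose proof (pr_le_l a b); pose proof (pr_le_r a b)
      end
  end.

Lemma prov_Proj X i v : prov X (pr 2 i) (lcode v) (nth i v 0).
Proof.
  revert v. induction i as [|i IH]; intros v.
  - apply (prov_step X 0 _ _ _ _ _ 0 0 0 0 (valid_0 X) (uncons_lcode v)); try lia.
    do 2 right; left. destruct v; auto.
  - destruct (IH (tl v)) as (c & Hc & Hm).
    apply (prov_step X c _ _ _ _ _ i 0 0 0 Hc (uncons_lcode v)); try lia.
    + left. pr_bounds. lia.
    + do 3 right; left. split; auto. destruct v as [|a v]; auto.
      now destruct i.
Qed.


Lemma eval_prov k X e v m : eval k X e v = Some m -> prov X (code e) (lcode v) m.
Proof.
  revert e v m. induction k as [|k IH]; intros e v m E; [discriminate|].
  destruct e as [| |i| |f gs|f g|f].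
  - injection E as <-.
    apply (prov_step X 0 _ _ _ _ _ 0 0 0 0 (valid_0 X) (uncons_lcode v)); try lia.
    left; auto.
  - injection E as <-.
    apply (prov_step X 0 _ _ _ _ _ 0 0 0 0 (valid_0 X) (uncons_lcode v)); try lia.
    right; left. destruct v; auto.
  - injection E as <-. apply prov_Proj.
  - injection E as <-.
    apply (prov_step X 0 _ _ _ _ _ 0 0 0 0 (valid_0 X) (uncons_lcode v)); try lia.
    do 4 right; left. split; auto. replace (nth 0 v 0) with (hd 0 v) by now destruct v.
    destruct (X (hd 0 v)); auto.
  - rewrite eval_Comp in E. destruct (evs _ gs) as [w|] eqn:Es; [|discriminate].
    assert (H : prov X (pr 7 (lcode (map code gs))) (lcode v) (lcode w)).
    { clear E. revert w Es. induction gs as [|g gs IHgs]; simpl; intros w Es.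
      - injection Es as <-.
        apply (prov_step X 0 _ _ _ _ _ 0 0 0 0 (valid_0 X) (uncons_lcode v)); try lia.
        do 6 right; left; auto.
      - destruct (eval k X g v) as [a|] eqn:Ea; [|discriminate].
        destruct (evs _ gs) as [w'|] eqn:Ew; [|discriminate].
        injection Es as <-. apply IH in Ea.
        destruct (prov2 _ _ _ _ _ _ _ Ea (IHgs _ eq_refl)) as (c & Hc & H1 & H2).
        pose proof (mem_lt _ _ _ _ H1). pose proof (mem_lt _ _ _ _ H2).
        apply (prov_step X c _ _ _ _ _ (code g) (lcode (map code gs)) a (lcode w') Hc
          (uncons_lcode v)); simpl; try (pr_bounds; lia).
        do 7 right; left; auto. }
    destruct (prov2 _ _ _ _ _ _ _ H (IH _ _ _ E)) as (c & Hc & H1 & H2).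
    pose proof (mem_lt _ _ _ _ H1). pose proof (mem_lt _ _ _ _ H2).
    apply (prov_step X c _ _ _ _ _ (code f) (lcode (map code gs)) (lcode w) 0 Hc
      (uncons_lcode v)); simpl; try (pr_bounds; lia).
    do 5 right; left; auto.
  - rewrite eval_Prim in E.
    (* The list [v'] varies because the recursion rule refers to a list with a smaller head and the
       same tail. *)
    assert (H : forall n m, primrec (eval k X f (tl v))
      (fun n r => eval k X g (n :: r :: tl v)) n = Some m ->
      forall v', hd 0 v' = n -> tl v' = tl v ->
      prov X (code (Prim f g)) (lcode v') m).
    { clear m E. induction n as [|n IHn]; simpl; intros m E v' Hh Ht.
      - apply IH in E as (c & Hc & H1).
        pose proof (mem_lt _ _ _ _ H1).
        apply (prov_step X c _ _ _ _ _ (code f) (code g) 0 0 Hc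
          (uncons_lcode v')); try (pr_bounds; lia).
        do 8 right; left. rewrite Ht. auto.
      - destruct (primrec _ _ n) as [r|] eqn:Er; [|discriminate].
        apply IH in E. specialize (IHn r eq_refl (n :: tl v) eq_refl eq_refl).
        destruct (prov2 _ _ _ _ _ _ _ IHn E) as (c & Hc & H1 & H2).
        pose proof (mem_lt _ _ _ _ H1). pose proof (mem_lt _ _ _ _ H2) as Hn.
        assert (n < c) by (revert Hn; simpl; pr_bounds; lia).
        apply (prov_step X c _ _ _ _ _ (code f) (code g) r n Hc
          (uncons_lcode v')); try (pr_bounds; lia).
        do 9 right; left. rewrite Hh, Ht. auto. }
    now apply (H (hd 0 v) m E v).
  - rewrite eval_Mu in E.
    assert (H : forall n y, musearch (fun y => eval k X f (y :: v)) n y = Some m ->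
      prov X (pr 8 (code f)) (lcode (y :: v)) m).
    { clear E. induction n as [|n IHn]; simpl; intros y E; [discriminate|].
      destruct (eval k X f (y :: v)) as [[|r]|] eqn:Ef; [| |discriminate]; apply IH in Ef.
      - injection E as <-. destruct Ef as (c & Hc & H1).
        apply (prov_step X c _ _ _ _ _ (code f) 0 0 0 Hc
          (uncons_lcode (y :: v))); try (pr_bounds; lia).
        do 11 right; left; auto.
      - destruct (prov2 _ _ _ _ _ _ _ Ef (IHn _ E)) as (c & Hc & H1 & H2).
        pose proof (mem_lt _ _ _ _ H1).
        apply (prov_step X c _ _ _ _ _ (code f) 0 r 0 Hc
          (uncons_lcode (y :: v))); try (pr_bounds; lia).
        do 12 right; auto. }
    destruct (H _ _ E) as (c & Hc & H1).
    apply (prov_step X c _ _ _ _ _ (code f) 0 0 0 Hc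
      (uncons_lcode v)); simpl; try (pr_bounds; lia).
    do 10 right; left; auto.
Qed.

(** Supplies the induction hypotheses for the list nested in [Comp]. *)
Lemma prf_ind_list (P : prf -> Prop) :
  P Zero -> P Succ -> (forall i, P (Proj i)) -> P Orc ->
  (forall f gs, P f -> List.Forall P gs -> P (Comp f gs)) ->
  (forall f g, P f -> P g -> P (Prim f g)) ->
  (forall f, P f -> P (Mu f)) -> forall e, P e.
Proof.
  intros H0 H1 H2 H3 H4 H5 H6. fix IH 1. intros [| |i| |f gs|f g|f].
  - exact H0.
  - exact H1.
  - apply H2.
  - exact H3.
  - apply H4; [apply IH|]. induction gs; constructor; [apply IH|assumption].
  - apply H5; apply IH.
  - apply H6, IH.
Qed.

Ltac invert_step Hs :=
  unfold step in Hs;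
  repeat match type of Hs with _ \/ _ => destruct Hs as [Hs|Hs] end;
  destruct Hs as [Heq Hs];
  apply pr_inj in Heq as [Htag Heq]; try discriminate Htag; clear Htag.

(* No well-foundedness of certificates is required: each rule passes to a subterm or
   to a smaller recursion argument, except in the search of [Mu], where the first
   argument increases but stays below [c]. *)
Lemma valid_sound c X e v m : valid c X -> mem c (code e) (lcode v) m -> ocomp e X v m.
Proof.
  intros Hc.
  assert (Hrule : forall e v m, mem c e (lcode v) m -> exists p q r w,
    step c X e (lcode v) m (hd 0 v) (lcode (tl v)) p q r w).
  { intros e0 v0 m0 H0. destruct (mem_lt _ _ _ _ H0) as (He0 & Hv0 & Hm0).
    destruct (Hc e0 He0 _ Hv0 m0 Hm0 H0)
      as (a & _ & u & _ & Hv & p & _ & q & _ & r & _ & w & _ & Hs).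
    apply lcode_uncons in Hv as [-> ->]. eauto. }
  revert v m. induction e as [| |i| |f gs IHf IHgs|f g IHf IHg|f IHf] using prf_ind_list;
    intros v m H.
  - destruct (Hrule _ _ _ H) as (p & q & r & w & Hs). simpl in Hs. invert_step Hs.
    subst. now exists 1.
  - destruct (Hrule _ _ _ H) as (p & q & r & w & Hs). simpl in Hs. invert_step Hs.
    subst. exists 1. now destruct v.
  - exists 1. simpl. f_equal.
    revert v m H. simpl. induction i as [|i IH]; intros v m H;
      destruct (Hrule _ _ _ H) as (p & q & r & w & Hs); invert_step Hs; try discriminate Heq.
    + subst. now destruct v.
    + injection Heq as <-. rewrite <- (IH _ _ Hs). destruct v as [|a v]; auto. now destruct i.
  - destruct (Hrule _ _ _ H) as (p & q & r & w & Hs). simpl in Hs. invert_step Hs.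
    exists 1. simpl. replace (nth 0 v 0) with (hd 0 v) by now destruct v.
    destruct Hs as [[-> ->]|[Hx ->]]; auto. now destruct (X (hd 0 v)).
  - destruct (Hrule _ _ _ H) as (p & q & r & w & Hs). simpl in Hs. invert_step Hs.
    apply pr_inj in Heq as [<- <-]. destruct Hs as [H1 H2].
    assert (exists rs, r = lcode rs /\ Forall2 (fun g a => ocomp g X v a) gs rs)
      as (rs & -> & Hrs).
    { clear H2 H. revert r H1. induction IHgs as [|g gs Hg _ IH]; intros r H1;
        destruct (Hrule _ _ _ H1) as (p & q & r' & w' & Hs); invert_step Hs;
        try discriminate Heq.
      - exists []. auto.
      - simpl in Heq. injection Heq as Heq. apply pr_inj in Heq as [<- <-].
        destruct Hs as (-> & H2 & H3). apply IH in H3 as (rs & -> & Hrs).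
        exists (r' :: rs). auto. }
    eapply ocomp_Comp; eauto.
  - remember (hd 0 v) as n eqn:Hn. revert v m Hn H.
    induction n as [|n IHn]; intros v m Hn H;
      destruct (Hrule _ _ _ H) as (p & q & r & w & Hs); simpl in Hs; invert_step Hs;
      apply pr_inj in Heq as [<- <-]; rewrite <- Hn in Hs; destruct Hs as [Hw Hs];
      try discriminate Hw.
    + apply ocomp_Prim_O; auto.
    + injection Hw as <-. destruct Hs as [H1 H2].
      apply (ocomp_Prim_S X f g v n r m); [now symmetry| |].
      * apply (IHn (n :: tl v)); auto.
      * apply (IHg (n :: r :: tl v)). exact H2.
  - destruct (Hrule _ _ _ H) as (p & q & r & w & Hs). simpl in Hs. invert_step Hs.
    subst p.
    assert (Hmu : forall d y, c <= y + d -> mem c (pr 8 (code f)) (lcode (y :: v)) m ->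
      (forall i, y <= i < m -> exists r, ocomp f X (i :: v) (S r)) /\ ocomp f X (m :: v) 0).
    { clear H Hs. induction d as [|d IHd]; intros y Hy H.
      - exfalso. pose proof (mem_lt _ _ _ _ H) as Hlt. revert Hlt. simpl. pr_bounds. lia.
      - destruct (Hrule _ _ _ H) as (p' & q' & r' & w' & Hs); invert_step Hs;
          subst p'; destruct Hs as [H1 H2].
        + simpl in H2. subst m. split; [intros i; lia|]. now apply IHf.
        + destruct (IHd (S y)) as [H3 H4]; [lia|exact H2|]. split; auto.
          intros i Hi. destruct (Nat.eq_dec i y) as [->|]; [|apply H3; lia].
          exists r'. now apply IHf. }
    destruct (Hmu c 0) as [H1 H2]; [lia|exact Hs|].
    apply ocomp_Mu; auto. intros y Hy. apply H1. lia.
Qed.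

Lemma ocomp_prov X e v m : ocomp e X v m -> prov X (code e) (lcode v) m.
Proof. intros [k Hk]. now apply eval_prov with k. Qed.

(** The use principle: a step queries the oracle only at [a], and [a < c]. Certificates below [t]
    therefore depend on [t] oracle bits only. *)
Lemma valid_ext c X X' : (forall i, i < c -> X i = X' i) -> valid c X -> valid c X'.
Proof.
  intros H Hc e He v Hv m Hm Hmem.
  destruct (Hc e He v Hv m Hm Hmem)
    as (a & Ha & u & Hu & Huv & p & Hp & q & Hq & r & Hr & w & Hw & Hs).
  exists a; split; [auto|]. exists u; split; [auto|]. split; auto.
  exists p; split; [auto|]. exists q; split; [auto|]. exists r; split; [auto|].
  exists w; split; [auto|]. unfold step in *. rewrite <- (H a Ha). exact Hs.
Qed.

(** * Counting *)

Lemma length_le_count_P {T} (P : T -> Prop) l L :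
  NoDup L -> (forall x, In x L -> In x l /\ P x) -> length L <= count_P P l.
Proof.
  intros HL H. apply NoDup_incl_length; auto. intros x Hx.
  apply filter_In. destruct (H x Hx) as [Hl HP]. split; auto.
  now destruct (excluded_middle_informative (P x)).
Qed.

Lemma cnt_ge P n L :
  NoDup L -> (forall x, In x L -> x < n /\ P x) -> length L <= cnt P n.
Proof.
  intros HL H. apply length_le_count_P; auto. intros x Hx.
  rewrite in_seq. destruct (H x Hx). split; [lia|auto].
Qed.

Lemma NoDup_map_in {A B} (f : A -> B) l :
  (forall x y, In x l -> In y l -> f x = f y -> x = y) -> NoDup l -> NoDup (map f l).
Proof.
  intros Hf Hl. induction Hl as [|x l Hx Hl IH]; simpl; constructor.
  - rewrite in_map_iff. intros (y & Hy & Hin). apply Hx.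
    now rewrite <- (Hf y x) by (simpl; auto).
  - apply IH. intros; apply Hf; simpl; auto.
Qed.

Lemma in_count_filter {T} (P : T -> Prop) l x :
  In x (filter (fun x => if excluded_middle_informative (P x) then true else false) l)
  <-> In x l /\ P x.
Proof.
  rewrite filter_In. now destruct (excluded_middle_informative (P x)).
Qed.

(** A relation takes the place of an injection, since the images, such as short programs, are known
    only to exist. *)
Lemma cnt_inj_le P n {T} (Q : T -> Prop) l (R : nat -> T -> Prop) :
  (forall i, i < n -> P i -> exists x, R i x /\ In x l /\ Q x) ->
  (forall i j x, R i x -> R j x -> i = j) -> cnt P n <= count_P Q l.
Proof.
  intros H Hinj.
  assert (exists L, NoDup L /\ length L = cnt P n /\
    forall x, In x L -> (In x l /\ Q x) /\ exists i, i < n /\ R i x) as (L & HL & <- & HQ).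
  { induction n as [|n IH].
    - exists []. split; [constructor|]. now split.
    - destruct IH as (L & HL & Hlen & HQ); [auto|]. rewrite cnt_S.
      destruct (excluded_middle_informative (P n)) as [p|p].
      + destruct (H n) as (x & Hx & Hl & Qx); auto.
        exists (x :: L). split; [|split; [simpl; lia|]].
        * constructor; auto. intros (_ & i & Hi & Ri)%HQ.
          pose proof (Hinj _ _ _ Ri Hx). lia.
        * intros y [<-|Hy]; [split; eauto|]. destruct (HQ y Hy) as (? & i & Hi & ?).
          split; auto. exists i; split; auto.
      + exists L. split; auto. split; [lia|]. intros y Hy.
        destruct (HQ y Hy) as (? & i & Hi & ?). split; auto. exists i; split; auto. }
  apply length_le_count_P; auto. intros x Hx. now apply HQ.
Qed.

Lemma cnt_or_le P Q R n :
  (forall i, i < n -> P i -> Q i \/ R i) -> cnt P n <= cnt Q n + cnt R n.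
Proof.
  induction n as [|n IH]; intros H; [reflexivity|]. rewrite !cnt_S.
  specialize (IH (fun i Hi => H i (Nat.lt_lt_succ_r _ _ Hi))).
  specialize (H n (Nat.lt_succ_diag_r n)).
  destruct (excluded_middle_informative (P n)), (excluded_middle_informative (Q n)),
    (excluded_middle_informative (R n)); try lia. tauto.
Qed.

Lemma cnt_eq_0 P n : (forall i, i < n -> ~ P i) -> cnt P n = 0.
Proof.
  intros H. destruct (Nat.eq_0_gt_0_cases (cnt P n)) as [|(i & Hi & HP)%cnt_pos]; auto.
  now apply H in HP.
Qed.

Lemma cnt_le P Q n : (forall i, i < n -> P i -> Q i) -> cnt P n <= cnt Q n.
Proof.
  intros H. pose proof (cnt_or_le P Q (fun _ => False) n) as H1.
  rewrite (cnt_eq_0 (fun _ => False)), Nat.add_0_r in H1 by auto. apply H1. auto.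
Qed.

Lemma cnt_disj_le P Q R n :
  (forall i, i < n -> Q i \/ R i -> P i) -> (forall i, i < n -> Q i -> ~ R i) ->
  cnt Q n + cnt R n <= cnt P n.
Proof.
  induction n as [|n IH]; intros H H'; [reflexivity|]. rewrite !cnt_S.
  specialize (IH (fun i Hi => H i (Nat.lt_lt_succ_r _ _ Hi))
                 (fun i Hi => H' i (Nat.lt_lt_succ_r _ _ Hi))).
  specialize (H n (Nat.lt_succ_diag_r n)). specialize (H' n (Nat.lt_succ_diag_r n)).
  destruct (excluded_middle_informative (P n)), (excluded_middle_informative (Q n)),
    (excluded_middle_informative (R n)); try lia; tauto.
Qed.

Lemma cnt_add P a b : cnt P (a + b) = cnt P a + cnt (fun i => P (a + i)) b.
Proof.
  induction b as [|b IH]; [unfold cnt at 3; simpl; now rewrite !Nat.add_0_r|].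
  rewrite Nat.add_succ_r, !cnt_S, IH. lia.
Qed.

(** * Covers by cylinders *)

(** A pair of a length and a number whose low bits spell the prefix. Higher bits have no effect, so
    one cylinder has many codes. *)
Definition cyl (C : nat * nat) (X : nat -> bool) : Prop :=
  forall j, j < fst C -> X j = Nat.testbit (snd C) j.

Definition wt (C : nat * nat) : R := ((/ 2) ^ fst C)%R.

Definition lsum {T} (f : T -> R) (l : list T) : R :=
  fold_right (fun x s => (f x + s)%R) 0%R l.

(** Bounding every finite duplicate-free part of the cover expresses total weight at most [d]
    without an enumeration or an infinite sum. *)
Definition covers (P : nat * nat -> Prop) (d : R) (S : (nat -> bool) -> Prop) : Prop :=
  (forall X, S X -> exists C, P C /\ cyl C X) /\
  forall L, NoDup L -> (forall C, In C L -> P C) -> (lsum wt L <= d)%R.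

Definition covered (d : R) (S : (nat -> bool) -> Prop) : Prop := exists P, covers P d S.

Lemma wt_pos C : (0 < wt C)%R.
Proof. apply pow_lt. lra. Qed.

Lemma lsum_app {T} (f : T -> R) l l' : lsum f (l ++ l') = (lsum f l + lsum f l')%R.
Proof. induction l as [|x l IH]; simpl; [lra|rewrite IH; lra]. Qed.

Lemma lsum_incl {T} (f : T -> R) l l' :
  (forall x, 0 <= f x)%R -> NoDup l -> incl l l' -> (lsum f l <= lsum f l')%R.
Proof.
  intros Hf Hl. revert l'. induction Hl as [|x l Hx Hl IH]; intros l' H; simpl.
  - clear H. induction l' as [|y l' IH]; simpl; [lra|]. specialize (Hf y). lra.
  - destruct (in_split x l') as (l1 & l2 & ->); [apply H; simpl; auto|].
    assert (incl l (l1 ++ l2)) as Hi.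
    { intros y Hy. specialize (H y (or_intror Hy)). rewrite in_app_iff in *.
      simpl in H. destruct H as [|[<-|]]; auto. contradiction. }
    apply IH in Hi. rewrite !lsum_app in *. simpl. lra.
Qed.

Lemma lsum_scal {T} (f : T -> R) c l : lsum (fun x => c * f x)%R l = (c * lsum f l)%R.
Proof. induction l as [|x l IH]; simpl; [lra|rewrite IH; lra]. Qed.

Lemma lsum_filter {T} (f : T -> R) p l :
  lsum f l = (lsum f (filter p l) + lsum f (filter (fun x => negb (p x)) l))%R.
Proof.
  induction l as [|x l IH]; simpl; [lra|]. rewrite IH.
  destruct (p x); simpl; lra.
Qed.

(** Each element is charged to the first index of [T] that claims it. *)
Lemma lsum_union {A I} (f : A -> R) (Q : I -> A -> Prop) (d : I -> R) T L :
  (forall i, In i T -> forall L, NoDup L -> (forall x, In x L -> Q i x) ->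
     (lsum f L <= d i)%R) ->
  NoDup L -> (forall x, In x L -> exists i, In i T /\ Q i x) ->
  (lsum f L <= lsum d T)%R.
Proof.
  revert L. induction T as [|i T IH]; intros L Hd HL HQ.
  - destruct L as [|x L]; [simpl; lra|]. destruct (HQ x) as (i & [] & _). simpl; auto.
  - set (p := fun x => if excluded_middle_informative (Q i x) then true else false).
    rewrite (lsum_filter f p L). simpl. apply Rplus_le_compat.
    + apply Hd; [simpl; auto|now apply NoDup_filter|].
      intros x Hx. now apply in_count_filter in Hx.
    + apply IH; [intros; apply Hd; simpl; auto|now apply NoDup_filter|].
      intros x [Hx Hp]%filter_In. destruct (HQ x Hx) as (j & [<-|Hj] & Hq); eauto.
      unfold p in Hp. now destruct (excluded_middle_informative (Q i x)).
Qed.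

Lemma covered_mono d d' (S S' : (nat -> bool) -> Prop) :
  (d <= d')%R -> (forall X, S' X -> S X) -> covered d S -> covered d' S'.
Proof.
  intros Hd HS (P & H1 & H2). exists P. split; auto.
  intros L HL HP. apply Rle_trans with d; auto.
Qed.

Lemma covered_union {I} (J : I -> Prop) (S : I -> (nat -> bool) -> Prop) (d : I -> R) D :
  (forall i, J i -> covered (d i) (S i)) ->
  (forall T, NoDup T -> (forall i, In i T -> J i) -> (lsum d T <= D)%R) ->
  covered D (fun X => exists i, J i /\ S i X).
Proof.
  intros HS HD.
  set (cov i := epsilon (inhabits (fun _ : nat * nat => False))
                  (fun P => covers P (d i) (S i))).
  assert (Hcov : forall i, J i -> covers (cov i) (d i) (S i)).
  { intros i Hi. apply epsilon_spec. now apply HS. }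
  exists (fun C => exists i, J i /\ cov i C). split.
  - intros X (i & Hi & HX). destruct (proj1 (Hcov i Hi) X HX) as (C & HC & HXC). eauto.
  - intros L HL HC.
    (* A finite part of the union meets finitely many of the chosen covers, so the bound on finite
       sums of [d] applies. *)
    assert (exists T, NoDup T /\ (forall i, In i T -> J i) /\
      forall x, In x L -> exists i, In i T /\ cov i x) as (T & HT & HJ & HLT).
    { clear HL. induction L as [|C L IH].
      - exists []. split; [constructor|]. now split.
      - destruct IH as (T & HT & HJ & HLT); [intros; apply HC; simpl; auto|].
        destruct (HC C) as (i & Hi & HiC); [simpl; auto|].
        destruct (classic (In i T)) as [Hin|Hin].
        + exists T. split; auto. split; auto. intros x [<-|Hx]; eauto.
        + exists (i :: T). split; [constructor; auto|split].
          * intros j [<-|Hj]; auto.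
          * intros x [<-|Hx]; [exists i; simpl; auto|].
            destruct (HLT x Hx) as (j & Hj & Hjx). exists j; simpl; auto. }
    apply Rle_trans with (lsum d T); auto.
    apply (lsum_union wt cov); auto.
    intros i Hi. apply (Hcov i (HJ i Hi)).
Qed.

Lemma NoDup_incl_seq T : exists N, incl T (seq 0 N).
Proof.
  exists (S (list_max T)). intros i Hi. apply in_seq. split; [lia|].
  pose proof (proj1 (list_max_le T (list_max T)) (le_n _)) as H.
  rewrite List.Forall_forall in H. specialize (H i Hi). lia.
Qed.

Lemma lsum_geom d N :
  lsum (fun i => d * (/ 2) ^ S i)%R (seq 0 N) = (d * (1 - (/ 2) ^ N))%R.
Proof.
  induction N as [|N IH]; [simpl; lra|].
  rewrite seq_S, lsum_app, IH. simpl. lra.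
Qed.

Lemma lsum_geom_le d T :
  (0 <= d)%R -> NoDup T -> (lsum (fun i => d * (/ 2) ^ S i)%R T <= d)%R.
Proof.
  intros Hd HT. destruct (NoDup_incl_seq T) as [N HN].
  apply Rle_trans with (lsum (fun i => d * (/ 2) ^ S i)%R (seq 0 N)).
  - apply lsum_incl; auto. intros i. apply Rmult_le_pos; auto. apply pow_le. lra.
  - rewrite lsum_geom. assert (0 <= (/ 2) ^ N)%R by (apply pow_le; lra). nra.
Qed.

Lemma covered_countable_union (S : nat -> (nat -> bool) -> Prop) :
  (forall N d, (0 < d)%R -> covered d (S N)) ->
  forall d, (0 < d)%R -> covered d (fun X => exists N, S N X).
Proof.
  intros HS d Hd.
  apply covered_mono with d (fun X => exists N, True /\ S N X); [lra|firstorder|].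
  apply covered_union with (fun i => d * (/ 2) ^ Datatypes.S i)%R.
  - intros i _. apply HS. apply Rmult_lt_0_compat; auto. apply pow_lt. lra.
  - intros T HT _. apply lsum_geom_le; auto. lra.
Qed.

Lemma half_pow_small d : (0 < d)%R -> exists k, ((/ 2) ^ k < d)%R.
Proof.
  intros Hd. destruct (pow_lt_1_zero (/ 2)) with d as [N HN]; auto.
  - rewrite Rabs_pos_eq; lra.
  - exists N. specialize (HN N (le_n _)). rewrite Rabs_pos_eq in HN; auto.
    apply pow_le. lra.
Qed.

(* A coarse form of the Lebesgue density theorem: a set covered at half price inside
   every cylinder is null, since its covers can be refined over and over. *)
Lemma covered_of_half (S : (nat -> bool) -> Prop) :
  (forall C, covered (/ 2 * wt C)%R (fun X => S X /\ cyl C X)) ->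
  forall d, (0 < d)%R -> covered d S.
Proof.
  intros H d Hd. destruct (half_pow_small d Hd) as [k Hk].
  apply covered_mono with ((/ 2) ^ k)%R S; [lra|auto|]. clear d Hd Hk.
  induction k as [|k (P & HP & HPsum)].
  - exists (fun C => C = (0, 0)). split.
    + intros X _. exists (0, 0). split; auto. intros j Hj. simpl in Hj. lia.
    + intros L HL HC. apply Rle_trans with (lsum wt [(0, 0)]).
      * apply lsum_incl; auto; [intros C; left; apply wt_pos|].
        intros C HC'. left. symmetry. auto.
      * unfold wt. simpl. lra.
  - apply covered_mono with ((/ 2) ^ Datatypes.S k)%R
      (fun X => exists C, P C /\ S X /\ cyl C X); [lra| |].
    + intros X HX. destruct (HP X HX) as (C & HC & HXC). eauto.
    + apply (covered_union P (fun C X => S X /\ cyl C X) (fun C => / 2 * wt C)%R); auto.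
      intros T HT HJ. rewrite lsum_scal. simpl.
      apply Rmult_le_compat_l; [lra|auto].
Qed.

Lemma sum_f_R0_lsum f n : sum_f_R0 f n = lsum f (seq 0 (S n)).
Proof.
  induction n as [|n IH]; [simpl; lra|].
  rewrite seq_S, lsum_app. simpl sum_f_R0. rewrite IH. simpl. lra.
Qed.

(** [null] demands a sequence of strings. All codes of cylinders are enumerated, and those outside
    the cover are replaced by strings so long that their total weight is at most [(/ 2) ^ k]; half
    of [d] pays for each kind. *)
Lemma null_of_covered (S : (nat -> bool) -> Prop) :
  (forall d, (0 < d)%R -> covered d S) -> null S.
Proof.
  intros H d Hd. destruct (H (d / 2)%R) as (P & HP & Hsum); [lra|].
  destruct (half_pow_small (d / 2)%R) as [k Hk]; [lra|].
  set (p C := if excluded_middle_informative (P C) then true else false).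
  exists (fun i => let C := Cantor.of_nat i in
    if p C then map (Nat.testbit (snd C)) (seq 0 (fst C))
    else repeat false (k + Datatypes.S i)). split.
  - intros X HX. destruct (HP X HX) as (C & HC & HXC).
    exists (Cantor.to_nat C). rewrite Cantor.cancel_of_to. unfold p.
    destruct (excluded_middle_informative (P C)); [|contradiction].
    intros j Hj. rewrite length_map, length_seq in Hj. rewrite HXC by auto.
    rewrite nth_indep with (d' := Nat.testbit (snd C) 0) by
      (now rewrite length_map, length_seq).
    now rewrite map_nth, seq_nth.
  - intros n. rewrite sum_f_R0_lsum. set (l := seq 0 (Datatypes.S n)).
    apply Rle_trans with (lsum wt (filter p (map Cantor.of_nat l))
      + lsum (fun i => (/ 2) ^ k * (/ 2) ^ Datatypes.S i)%R l)%R.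
    + set (h := fun i => ((/ 2) ^ k * (/ 2) ^ Datatypes.S i)%R).
      match goal with |- (lsum ?f l <= _)%R => set (g := f) end.
      assert (Hh : forall i, (0 <= h i)%R)
        by (intros i; apply Rmult_le_pos; apply pow_le; lra).
      assert (Hg : forall i, g i = if p (Cantor.of_nat i) then wt (Cantor.of_nat i) else h i).
      { intros i. unfold g. cbv zeta. destruct (p (Cantor.of_nat i)).
        - now rewrite length_map, length_seq.
        - now rewrite repeat_length, pow_add. }
      clearbody g h. induction l as [|i l' IH]; [simpl; lra|].
      simpl. rewrite Hg. specialize (Hh i). destruct (p (Cantor.of_nat i)); simpl; lra.
    + assert (lsum wt (filter p (map Cantor.of_nat l)) <= d / 2)%R.
      { apply Hsum.
        - apply NoDup_filter, NoDup_map_in; [|apply seq_NoDup].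
          intros x y _ _ E. rewrite <- (Cantor.cancel_to_of x), E.
          apply Cantor.cancel_to_of.
        - intros C HC. now apply in_count_filter in HC. }
      assert (lsum (fun i => (/ 2) ^ k * (/ 2) ^ Datatypes.S i)%R l <= (/ 2) ^ k)%R.
      { apply lsum_geom_le; [apply pow_le; lra|apply seq_NoDup]. }
      lra.
Qed.

Lemma covered_level t (B : nat -> Prop) :
  covered (INR (cnt B (2 ^ t)) * (/ 2) ^ t)%R
    (fun X => exists a, a < 2 ^ t /\ B a /\ cyl (t, a) X).
Proof.
  exists (fun C => fst C = t /\ snd C < 2 ^ t /\ B (snd C)). split.
  - intros X (a & Ha & HB & HX). exists (t, a). auto.
  - intros L HL HP.
    assert (E : lsum wt L = (INR (length L) * (/ 2) ^ t)%R).
    { clear HL. induction L as [|C L IH]; [simpl; lra|].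
      simpl lsum. rewrite IH by (intros; apply HP; simpl; auto).
      simpl length. rewrite S_INR. unfold wt.
      rewrite (proj1 (HP C (or_introl eq_refl))). lra. }
    rewrite E. apply Rmult_le_compat_r; [apply pow_le; lra|]. apply le_INR.
    rewrite <- (length_map snd L). apply cnt_ge.
    + apply NoDup_map_in; auto. intros [t1 a1] [t2 a2] H1 H2 Ha. simpl in Ha.
      destruct (HP _ H1) as [E1 _], (HP _ H2) as [E2 _]. simpl in *. congruence.
    + intros a Ha. apply in_map_iff in Ha as (C & <- & HC). apply HP in HC. tauto.
Qed.

Lemma cyl_mod t a X : cyl (S t, a) X -> cyl (t, a mod 2 ^ t) X.
Proof.
  intros H j Hj. simpl in *. rewrite Nat.mod_pow2_bits_low by auto. apply H. simpl. lia.
Qed.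

(** Continuity from below: the first hypothesis makes the level sets increase with [t], so their
    union costs no more than a bound common to all levels. *)
Lemma covered_levels (H : nat -> nat -> Prop) D :
  (forall t a, a < 2 ^ S t -> H t (a mod 2 ^ t) -> H (S t) a) ->
  (forall t, INR (cnt (H t) (2 ^ t)) * (/ 2) ^ t <= D)%R ->
  covered D (fun X => exists t a, a < 2 ^ t /\ H t a /\ cyl (t, a) X).
Proof.
  intros Hext HD.
  (* Only cylinders that enter at level [t] are paid for. *)
  set (new t := match t with
                | O => H 0
                | S t' => fun a => H t a /\ ~ H t' (a mod 2 ^ t')
                end).
  set (d t := (INR (cnt (new t) (2 ^ t)) * (/ 2) ^ t)%R).
  apply covered_mono with D (fun X => exists t, True /\
    exists a, a < 2 ^ t /\ new t a /\ cyl (t, a) X); [lra| |].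
  - intros X (t & Ht). induction t as [|t IH].
    + exists 0. split; auto.
    + destruct (classic (exists a, a < 2 ^ t /\ H t a /\ cyl (t, a) X)) as [Hex|Hno];
        [auto|].
      destruct Ht as (a & Ha & Hta & HX). exists (S t). split; auto.
      exists a. split; auto. split; auto. split; auto. intros Hn.
      apply Hno. exists (a mod 2 ^ t). split; [|split; auto using cyl_mod].
      apply Nat.mod_upper_bound, Nat.pow_nonzero. lia.
  - apply (covered_union _ _ d); [intros; apply covered_level|].
    intros T HT _. destruct (NoDup_incl_seq T) as [N HN].
    assert (incl T (seq 0 (S N))) as HN'.
    { intros i Hi. apply HN in Hi. rewrite in_seq in *. lia. }
    apply Rle_trans with (lsum d (seq 0 (S N))).
    { apply lsum_incl; auto. intros t. apply Rmult_le_pos; [apply pos_INR|apply pow_le; lra]. }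
    apply Rle_trans with (INR (cnt (H N) (2 ^ N)) * (/ 2) ^ N)%R; [|apply HD].
    clear HN HN' HT T HD. induction N as [|N IH]; [unfold d; simpl; lra|].
    rewrite seq_S, lsum_app.
    apply Rle_trans with (INR (cnt (H N) (2 ^ N)) * (/ 2) ^ N + d (S N))%R;
      [simpl in *; lra|].
    (* Each old cylinder splits into two that remain in [H]; after scaling, the costs of the new
       ones telescope. *)
    assert (E : cnt (new (S N)) (2 ^ S N) + 2 * cnt (H N) (2 ^ N) <= cnt (H (S N)) (2 ^ S N)).
    { assert (Hp : 2 ^ N <> 0) by (apply Nat.pow_nonzero; lia).
      assert (E : 2 * cnt (H N) (2 ^ N) <= cnt (fun a => H N (a mod 2 ^ N)) (2 ^ S N)).
      { replace (2 ^ S N) with (2 ^ N + 2 ^ N) by (simpl; lia). rewrite cnt_add.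
        assert (cnt (H N) (2 ^ N) <= cnt (fun a => H N (a mod 2 ^ N)) (2 ^ N)).
        { apply cnt_le. intros i Hi. now rewrite Nat.mod_small. }
        assert (cnt (H N) (2 ^ N) <= cnt (fun i => H N ((2 ^ N + i) mod 2 ^ N)) (2 ^ N)).
        { apply cnt_le. intros i Hi.
          replace (2 ^ N + i) with (i + 1 * 2 ^ N) by lia.
          now rewrite Nat.Div0.mod_add, Nat.mod_small. }
        lia. }
      pose proof (cnt_disj_le (H (S N)) (new (S N)) (fun a => H N (a mod 2 ^ N)) (2 ^ S N)) as E'.
      simpl new in *. enough (cnt (fun a => H (S N) a /\ ~ H N (a mod 2 ^ N)) (2 ^ S N) +
        cnt (fun a => H N (a mod 2 ^ N)) (2 ^ S N) <= cnt (H (S N)) (2 ^ S N)) by lia.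
      apply E'.
      - intros i Hi [[Hi' _]|Hi']; auto.
      - intros i Hi [_ Hn]. exact Hn. }
    apply le_INR in E. rewrite plus_INR, mult_INR in E.
    replace (INR 2) with 2%R in E by reflexivity.
    assert (0 < (/ 2) ^ N)%R by (apply pow_lt; lra).
    unfold d. rewrite <- (tech_pow_Rmult (/ 2) N). nra.
Qed.

(** * Strings *)

Lemma enc_surj x : exists w, enc w = x.
Proof.
  induction x as [x IH] using lt_wf_ind. destruct x as [|x]; [now exists []|].
  pose proof (Nat.div_mod_eq x 2) as E. pose proof (Nat.mod_upper_bound x 2 ltac:(lia)).
  destruct (IH (x / 2)) as [w Hw].
  { apply Nat.lt_succ_r, Nat.Div0.div_le_upper_bound. lia. }
  destruct (x mod 2) as [|[|r]] eqn:Er.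
  - exists (false :: w). cbn [enc]. lia.
  - exists (true :: w). cbn [enc]. lia.
  - lia.
Qed.

(** Hence [S y < 2 ^ S n] says below that [y] codes a string of length at most [n]. *)
Lemma enc_length w : 2 ^ length w <= S (enc w) < 2 ^ S (length w).
Proof.
  induction w as [|b w IH]; [simpl; lia|]. cbn [enc length] in *.
  rewrite !Nat.pow_succ_r' in *. destruct b; lia.
Qed.

Lemma in_strs_len w : In w (strs_len (length w)).
Proof.
  induction w as [|b w IH]; [now left|]. cbn [length strs_len].
  rewrite in_app_iff, !in_map_iff. destruct b; eauto.
Qed.

Lemma in_strs_upto w n : length w <= n -> In w (strs_upto n).
Proof.
  intros H. apply in_flat_map. exists (length w). split; [|apply in_strs_len].
  apply in_seq. lia.
Qed.

Lemma length_strs_len n : length (strs_len n) = 2 ^ n.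
Proof.
  induction n as [|n IH]; [reflexivity|]. cbn [strs_len].
  rewrite length_app, !length_map. unfold str in *. rewrite IH. simpl. lia.
Qed.

Lemma length_strs_upto n : S (length (strs_upto n)) = 2 ^ S n.
Proof.
  unfold strs_upto. induction n as [|n IH]; [reflexivity|].
  rewrite seq_S, flat_map_app, length_app.
  change (flat_map strs_len [0 + S n]) with (strs_len (S n) ++ []).
  rewrite app_nil_r, length_strs_len, (Nat.pow_succ_r' 2 (S n)).
  unfold str in *. lia.
Qed.

Lemma least_nat (P : nat -> Prop) :
  (exists n, P n) -> exists n, P n /\ forall k, k < n -> ~ P k.
Proof.
  intros [n Hn]. revert Hn. induction n as [n IH] using lt_wf_ind. intros Hn.
  destruct (classic (exists k, k < n /\ P k)) as [(k & Hk & HP)|H]; eauto.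
  exists n. split; auto. intros k Hk HP. eauto.
Qed.

Lemma eventually_all (Q : nat -> nat -> Prop) M :
  (forall y, y < M -> exists b, forall t, b <= t -> Q y t) ->
  exists b, forall t, b <= t -> forall y, y < M -> Q y t.
Proof.
  induction M as [|M IH]; intros H; [exists 0; intros; lia|].
  destruct IH as [b Hb]; [auto|]. destruct (H M) as [b' Hb']; auto.
  exists (b + b'). intros t Ht y Hy.
  destruct (Nat.eq_dec y M) as [->|]; [apply Hb'; lia|apply Hb; lia].
Qed.

Fixpoint trunc (X : nat -> bool) (t : nat) : nat :=
  match t with
  | O => 0
  | S t' => 2 * trunc (fun i => X (S i)) t' + Nat.b2n (X 0)
  end.

Lemma trunc_lt X t : trunc X t < 2 ^ t.
Proof.
  revert X. induction t as [|t IH]; intros X; [simpl; lia|].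
  cbn [trunc]. rewrite Nat.pow_succ_r'. specialize (IH (fun i => X (S i))).
  destruct (X 0); simpl Nat.b2n; lia.
Qed.

Lemma trunc_testbit X t i : i < t -> Nat.testbit (trunc X t) i = X i.
Proof.
  revert X i. induction t as [|t IH]; intros X i Hi; [lia|].
  cbn [trunc]. destruct i as [|i]; [apply Nat.testbit_0_r|].
  rewrite Nat.testbit_succ_r. apply (IH (fun i => X (S i))). lia.
Qed.

Lemma cyl_trunc X t : cyl (t, trunc X t) X.
Proof. intros i Hi. symmetry. now apply trunc_testbit. Qed.

(** * Late programs *)

(* Here [t] bounds the certificates, [o] holds the first [t] bits of the oracle, and
   [u] and [f] are codes of the optimal machine and of the algorithm. *)
Definition eval_by (t o e y m : nat) : Prop :=
  exists c, c < t /\ valid c (Nat.testbit o) /\ mem c e (S (pr y 0)) m.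

Definition halts_by (t u y : nat) : Prop := exists m, m < t /\ eval_by t 0 u y m.

Definition correct_by (t o f u y : nat) : Prop :=
  exists m, m < t /\ eval_by t o f y m /\
    (m = 0 /\ ~ halts_by t u y \/ m <> 0 /\ halts_by t u y).

(** A quarter of [2 ^ L] is allowed here and again in [accurate]; the two together stay below the
    [2 ^ L] late programs. *)
Definition good_oracle (t u d f L o : nat) : Prop :=
  4 * cnt (fun y => S y < 2 ^ S (L + d) /\ ~ correct_by t o f u y) (2 ^ S (L + d)) <= 2 ^ L.

(** For [w < 2 ^ l] this says that the low [l] bits of [o] are [w]. *)
Definition extends (l w o : nat) : Prop := exists q, q < S o /\ o = q * 2 ^ l + w.

(* The length [L] of a program encodes all parameters of the search; the padding [N]
   makes every choice of parameters occur at arbitrarily large lengths. *)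
Definition good (u t L : nat) : Prop :=
  exists d, d < S L /\ exists f, f < S L /\ exists l, l < S L /\ exists w, w < S L /\
  exists N, N < S L /\ L = pr d (pr f (pr l (pr w N))) /\ l <= t /\
  2 ^ t < 2 * (2 ^ l * cnt (fun o => extends l w o /\ good_oracle t u d f L o) (2 ^ t)).

Definition good_for_program (u t x : nat) : Prop :=
  exists L, L < S x /\ 2 ^ L <= S x /\ S x < 2 ^ S L /\ good u t L.

Lemma decid_good_for_program u : decid 2 (fun s => good_for_program u (s 0) (s 1)).
Proof.
  unfold good_for_program, good, extends, good_oracle, correct_by, halts_by, eval_by,
    valid, justified, uncons, step, mem, atom.
  solve_decid. 
Qed.

(** The output [x + t] is at least the stage [t], and it separates inputs that share a stage, as all
    strings of one length will. *)
Lemma search_machine (P : nat -> nat -> Prop) :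
  decid 2 (fun s => P (s 0) (s 1)) ->
  exists V : machine, forall X x t, P t x -> (forall k, k < t -> ~ P k x) ->
    ocomp V X [x] (x + t).
Proof.
  intros (f & [e He] & HP).
  destruct (cf_add 2 (fun s => s 0) (fun s => s 1) (cf_var 2 0) (cf_var 2 1)) as [ea Ha].
  exists (Comp ea [Proj 0; Mu e]). intros X x t Ht Hk.
  apply ocomp_Comp with [x; t]; [|now apply (Ha X [x; t])].
  constructor; [now exists 1|]. constructor; [|constructor].
  apply ocomp_Mu.
  - intros y Hy. apply Hk in Hy. specialize (He X [y; x] eq_refl).
    specialize (HP (env [y; x])). simpl in HP. destruct (f (env [y; x])) as [|r].
    + exfalso. apply Hy, HP. reflexivity.
    + eauto.
  - specialize (He X [t; x] eq_refl). apply (HP (env [t; x])) in Ht. now rewrite Ht in He.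
Qed.

Lemma pow2_unique L L' x :
  2 ^ L <= x < 2 ^ S L -> 2 ^ L' <= x < 2 ^ S L' -> L = L'.
Proof.
  intros H H'. rewrite <- (Nat.log2_unique x L), <- (Nat.log2_unique x L'); auto; lia.
Qed.

Lemma good_for_program_iff u t x L :
  2 ^ L <= S x < 2 ^ S L -> good_for_program u t x <-> good u t L.
Proof.
  intros H. split.
  - intros (L' & _ & H1 & H2 & HG). now rewrite (pow2_unique L L' (S x)).
  - intros HG. exists L. pose proof (Nat.pow_gt_lin_r 2 L). split; [lia|tauto].
Qed.

Lemma is_C_le V p x : runs V p x -> exists k, is_C V x k /\ k <= length p.
Proof.
  intros H. destruct (least_nat (fun k => exists p, runs V p x /\ length p = k))
    as (k & Hk & Hmin); [eauto|].
  exists k. split; [split; auto|].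
  - intros q Hq. apply Nat.nlt_ge. intros Hlt. apply (Hmin _ Hlt). eauto.
  - apply Nat.nlt_ge. intros Hlt. apply (Hmin _ Hlt). eauto.
Qed.

Definition halts (U : machine) (y : nat) : Prop := exists m, ocomp U (fun _ => false) [y] m.

Lemma eval_by_sound t o X e y m :
  (forall i, i < t -> Nat.testbit o i = X i) ->
  eval_by t o (code e) y m -> ocomp e X [y] m.
Proof.
  intros H (c & Hc & Hv & Hm). apply (valid_sound c).
  - apply valid_ext with (2 := Hv). intros i Hi. apply H. lia.
  - exact Hm.
Qed.

Lemma halts_by_sound t U y m :
  eval_by t 0 (code U) y m -> ocomp U (fun _ => false) [y] m.
Proof. apply eval_by_sound. intros i _. apply Nat.bits_0. Qed.

Lemma eval_by_complete X e y m :
  ocomp e X [y] m -> exists b, forall t, b <= t -> m < t /\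
    forall o, (forall i, i < t -> Nat.testbit o i = X i) -> eval_by t o (code e) y m.
Proof.
  intros H. apply ocomp_prov in H as (c & Hc & Hm). exists (S c). intros t Ht.
  pose proof (mem_lt _ _ _ _ Hm). split; [lia|]. intros o Ho.
  exists c. split; [lia|]. split; auto. apply valid_ext with (2 := Hc).
  intros i Hi. symmetry. apply Ho. lia.
Qed.

Lemma eval_by_mono t o o' e y m :
  (forall i, i < t -> Nat.testbit o i = Nat.testbit o' i) ->
  eval_by t o e y m -> eval_by (S t) o' e y m.
Proof.
  intros H (c & Hc & Hv & Hm). exists c. split; [lia|]. split; auto.
  apply valid_ext with (2 := Hv). intros i Hi. apply H. lia.
Qed.

Lemma halts_by_eventually U M :
  exists b, forall t, b <= t -> forall y, y < M -> halts_by t (code U) y <-> halts U y.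
Proof.
  apply (eventually_all (fun y t => halts_by t (code U) y <-> halts U y)). intros y _.
  destruct (classic (halts U y)) as [[m Hm]|Hn].
  - destruct (eval_by_complete _ _ _ _ Hm) as [b Hb]. exists b. intros t Ht.
    destruct (Hb t Ht) as [Hmt Ho]. split; intros _; [now exists m|].
    exists m. split; auto. apply Ho. intros i _. apply Nat.bits_0.
  - exists 0. intros t _. split; [|tauto]. intros (m & _ & Hm). exists m.
    now apply halts_by_sound in Hm.
Qed.

Lemma cnt_True n : cnt (fun _ => True) n = n.
Proof.
  induction n as [|n IH]; [reflexivity|].
  rewrite cnt_S, IH. destruct (excluded_middle_informative True); [lia|tauto].
Qed.

(* The strings [x + t], with [x] the number of a string of length [L], are not outputs
   of programs halting by stage [t], since those outputs are below [t]. *)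
Lemma many_late_programs (U V : machine) c L t :
  (forall X x t, good_for_program (code U) t x ->
     (forall k, k < t -> ~ good_for_program (code U) k x) -> ocomp V X [x] (x + t)) ->
  (forall x k, is_C V x k -> exists k', is_C U x k' /\ k' <= k + c) ->
  good (code U) t L -> (forall k, k < t -> ~ good (code U) k L) ->
  2 ^ L <= cnt (fun y => S y < 2 ^ S (L + c) /\ halts U y /\ ~ halts_by t (code U) y)
               (2 ^ S (L + c)).
Proof.
  intros HV HC HG Hmin.
  rewrite <- (cnt_True (2 ^ L)) at 1.
  assert (Hp : 2 ^ L <> 0) by (apply Nat.pow_nonzero; lia).
  apply cnt_inj_le with (R := fun i y => ocomp U (fun _ => false) [y] (Nat.pred (2 ^ L) + i + t)).
  - intros i Hi _. set (x := Nat.pred (2 ^ L) + i).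
    assert (Hx : 2 ^ L <= S x < 2 ^ S L) by (rewrite Nat.pow_succ_r'; unfold x; lia).
    assert (HVx : ocomp V (fun _ => false) [x] (x + t)).
    { apply HV; [now apply (good_for_program_iff _ _ x L)|]. intros k Hk H.
      apply (Hmin k Hk). now apply (good_for_program_iff _ _ x L). }
    destruct (enc_surj x) as [p Ep], (enc_surj (x + t)) as [z Ez].
    destruct (is_C_le V p z) as (k & Hk & Hkp).
    { unfold runs. now rewrite Ep, Ez. }
    destruct (HC z k Hk) as (k' & [(q & Hq & Hlq) _] & Hk').
    assert (length p = L) as Hp'.
    { apply (pow2_unique _ _ (S x)); auto. rewrite <- Ep. apply enc_length. }
    unfold runs in Hq. rewrite Ez in Hq. exists (enc q). split; [exact Hq|].
    assert (Hlt : S (enc q) < 2 ^ S (L + c)).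
    { apply Nat.lt_le_trans with (2 ^ S (length q)); [apply enc_length|].
      apply Nat.pow_le_mono_r; lia. }
    split; [apply in_seq; lia|]. split; auto. split; [now exists (x + t)|].
    intros (m & Hm & Hby). apply halts_by_sound in Hby.
    pose proof (ocomp_fun _ _ _ _ _ Hq Hby). lia.
  - intros i j y Hi Hj. pose proof (ocomp_fun _ _ _ _ _ Hi Hj). lia.
Qed.

(** * Accurate oracles form a null set *)

Definition correct (U Phi : prf) (X : nat -> bool) (y : nat) : Prop :=
  exists m, ocomp Phi X [y] m /\ (m = 0 /\ ~ halts U y \/ m <> 0 /\ halts U y).

Definition accurate (U Phi : prf) (c : nat) (X : nat -> bool) (L : nat) : Prop :=
  4 * cnt (fun y => S y < 2 ^ S (L + c) /\ ~ correct U Phi X y) (2 ^ S (L + c)) <= 2 ^ L.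

(** The hypothesis is the failure of the majority condition in [good]; the conclusion is the price
    asked by [covered_of_half] for a cylinder of length [l]. *)
Lemma half_weight_bound B l t :
  2 * (2 ^ l * B) <= 2 ^ t -> (INR B * (/ 2) ^ t <= / 2 * (/ 2) ^ l)%R.
Proof.
  intros H. apply le_INR in H. rewrite !mult_INR, !pow_INR in H.
  replace (INR 2) with 2%R in H by reflexivity. rewrite !pow_inv.
  assert (0 < 2 ^ t)%R by (apply pow_lt; lra).
  assert (0 < 2 ^ l)%R by (apply pow_lt; lra).
  apply Rmult_le_reg_r with (2 * 2 ^ l * 2 ^ t)%R; [nra|].
  field_simplify; lra.
Qed.

Lemma cnt_extends l w t : l <= t -> cnt (extends l w) (2 ^ t) <= 2 ^ (t - l).
Proof.
  intros H. rewrite <- (cnt_True (2 ^ (t - l))).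
  apply cnt_inj_le with (R := fun o q => o = q * 2 ^ l + w).
  - intros o Ho (q & _ & ->). exists q. split; auto. split; auto.
    apply in_seq. replace t with (t - l + l) in Ho by lia. rewrite Nat.pow_add_r in Ho.
    split; [lia|]. assert (2 ^ l <> 0) by (apply Nat.pow_nonzero; lia). nia.
  - intros i j q -> ->. reflexivity.
Qed.

Lemma extends_of_cyl l a t o X :
  l <= t -> cyl (l, a) X -> cyl (t, o) X -> extends l (a mod 2 ^ l) o.
Proof.
  intros Hl Ha Ho. assert (Hp : 2 ^ l <> 0) by (apply Nat.pow_nonzero; lia).
  replace (a mod 2 ^ l) with (o mod 2 ^ l).
  - pose proof (Nat.div_mod_eq o (2 ^ l)). exists (o / 2 ^ l). split; nia.
  - apply Nat.bits_inj. intros i. destruct (Nat.lt_ge_cases i l) as [Hi|Hi].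
    + rewrite !Nat.mod_pow2_bits_low by auto.
      specialize (Ha i Hi). specialize (Ho i). simpl in *. rewrite <- Ha. symmetry.
      apply Ho. lia.
    + now rewrite !Nat.mod_pow2_bits_high.
Qed.

Lemma extends_of_mod l w t o : l <= t -> extends l w (o mod 2 ^ t) -> extends l w o.
Proof.
  intros Hl (q & _ & E). pose proof (Nat.div_mod_eq o (2 ^ t)) as Ho.
  replace (2 ^ t) with (2 ^ (t - l) * 2 ^ l) in Ho at 1
    by (rewrite <- Nat.pow_add_r; f_equal; lia).
  assert (2 ^ l <> 0) by (apply Nat.pow_nonzero; lia).
  exists (2 ^ (t - l) * (o / 2 ^ t) + q). split; nia.
Qed.

(** The threshold depends on [X], which is why a union over all stages has to be covered rather than
    one level. *)
Lemma correct_by_eventually U Phi X M :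
  exists b, forall t, b <= t -> forall y, y < M -> correct U Phi X y ->
    correct_by t (trunc X t) (code Phi) (code U) y.
Proof.
  destruct (halts_by_eventually U M) as [b0 Hb0].
  apply (eventually_all (fun y t => correct U Phi X y ->
    correct_by t (trunc X t) (code Phi) (code U) y)). intros y Hy.
  destruct (classic (correct U Phi X y)) as [(m & Hm & Hc)|Hn];
    [|exists 0; tauto].
  destruct (eval_by_complete _ _ _ _ Hm) as [b Hb]. exists (b + b0). intros t Ht _.
  destruct (Hb t) as [Hmt Ho]; [lia|]. exists m. split; auto. split.
  - apply Ho. intros i. apply trunc_testbit.
  - rewrite (Hb0 t) by (auto; lia). exact Hc.
Qed.

Lemma correct_by_extend t o f u y :
  (halts_by (S t) u y <-> halts_by t u y) ->
  correct_by t (o mod 2 ^ t) f u y -> correct_by (S t) o f u y.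
Proof.
  intros Hh (m & Hm & He & Hc). exists m. split; [lia|]. rewrite Hh. split; auto.
  apply eval_by_mono with (2 := He). intros i. apply Nat.mod_pow2_bits_low.
Qed.

(** Being right at stage [t] means answering 0, as [y] has not halted by then. The answer is final,
    so it becomes wrong once [y] halts. *)
Lemma late_not_correct U Phi X t y :
  halts U y -> ~ halts_by t (code U) y ->
  correct_by t (trunc X t) (code Phi) (code U) y -> ~ correct U Phi X y.
Proof.
  intros Hy Hby (m & _ & He & Hc) (m' & Hm' & Hc').
  apply (eval_by_sound t _ X) in He; [|intros i; apply trunc_testbit].
  rewrite (ocomp_fun _ _ _ _ _ Hm' He) in Hc'. tauto.
Qed.

Lemma accurate_null (U V : machine) c Phi N d :
  (forall X x t, good_for_program (code U) t x ->
     (forall k, k < t -> ~ good_for_program (code U) k x) -> ocomp V X [x] (x + t)) ->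
  (forall x k, is_C V x k -> exists k', is_C U x k' /\ k' <= k + c) ->
  (0 < d)%R -> covered d (fun X => forall L, N <= L -> accurate U Phi c X L).
Proof.
  intros HV HC. revert d. apply covered_of_half. intros [l a].
  apply NNPP. intros Hnc. unfold wt in Hnc. simpl fst in Hnc.
  set (w := a mod 2 ^ l) in *.
  (* A single length gives the contradiction; having [N] as a component puts it in the range where
     accuracy is assumed. *)
  set (L := pr c (pr (code Phi) (pr l (pr w N)))).
  assert (HNL : N <= L) by (unfold L; pr_bounds; lia).
  set (M := 2 ^ S (L + c)).
  set (G t o := extends l w o /\ good_oracle t (code U) c (code Phi) L o).
  assert (Hgood : forall t,
    good (code U) t L <-> l <= t /\ 2 ^ t < 2 * (2 ^ l * cnt (G t) (2 ^ t))).
  { intros t. split; cycle 1.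
    - intros H. exists c. split; [unfold L; pr_bounds; lia|].
      exists (code Phi). split; [unfold L; pr_bounds; lia|].
      exists l. split; [unfold L; pr_bounds; lia|].
      exists w. split; [unfold L; pr_bounds; lia|].
      exists N. split; [lia|]. auto.
    - intros (d' & _ & f' & _ & l' & _ & w' & _ & N' & _ & E & H).
      unfold L in E at 1. apply pr_inj in E as [<- E]. apply pr_inj in E as [<- E].
      apply pr_inj in E as [<- E]. apply pr_inj in E as [<- _]. exact H. }
  assert (Hex : exists t, good (code U) t L).
  { apply NNPP. intros Hno. apply Hnc.
    (* Only stages from [t0 + l] on are counted: there the halting status below [M] is final, so a
       good oracle stays good when extended, as [covered_levels] requires. *)
    destruct (halts_by_eventually U M) as [t0 Ht0].
    apply covered_mono with (/ 2 * (/ 2) ^ l)%R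
      (fun X => exists t o, o < 2 ^ t /\ (t0 + l <= t /\ G t o) /\ cyl (t, o) X); [lra| |].
    - intros X [HX Ha]. destruct (correct_by_eventually U Phi X M) as [b Hb].
      set (t := b + t0 + l). exists t, (trunc X t).
      split; [apply trunc_lt|]. split; [|apply cyl_trunc].
      split; [lia|]. split.
      + apply extends_of_cyl with t X; auto; [lia|apply cyl_trunc].
      + unfold good_oracle. eapply Nat.le_trans; [|apply (HX L HNL)].
        apply Nat.mul_le_mono_l, cnt_le. intros y _ [Hy Hn]. split; auto.
        intros Hc. apply Hn, Hb; auto; [lia|]. fold M in Hy. lia.
    - apply (covered_levels (fun t o => t0 + l <= t /\ G t o)).
      + intros t o _ [Ht [He Hg]]. split; [lia|]. split.
        * apply extends_of_mod with t; auto. lia.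
        * unfold good_oracle in *. eapply Nat.le_trans; [|apply Hg].
          apply Nat.mul_le_mono_l, cnt_le. intros y _ [Hy Hn]. split; auto.
          intros Hc. apply Hn. apply correct_by_extend; auto.
          fold M in Hy. rewrite !Ht0 by lia. reflexivity.
      + intros t. destruct (Nat.le_gt_cases (t0 + l) t) as [Ht|Ht].
        * apply half_weight_bound. apply Nat.nlt_ge. intros Hlt. apply Hno.
          exists t. apply Hgood. split; [lia|].
          eapply Nat.lt_le_trans; [exact Hlt|].
          apply Nat.mul_le_mono_l, Nat.mul_le_mono_l, cnt_le. tauto.
        * replace (cnt _ _) with 0.
          { simpl. rewrite Rmult_0_l. apply Rmult_le_pos; [lra|apply pow_le; lra]. }
          symmetry. apply cnt_eq_0. intros o _ [Hlt _]. lia. }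
  destruct (least_nat _ Hex) as (t & Ht & Hmin). clear Hex.
  pose proof (many_late_programs U V c L t HV HC Ht Hmin) as Hlate. fold M in Hlate.
  apply Hgood in Ht as [Hlt Ht].
  (* Otherwise every accurate oracle of the cylinder lies in one of the bad extensions, fewer than
     half of the [2 ^ (t - l)] extensions. *)
  assert (Hex : exists X, (forall L, N <= L -> accurate U Phi c X L) /\ G t (trunc X t)).
  { apply NNPP. intros Hno. apply Hnc.
    set (B o := extends l w o /\ ~ good_oracle t (code U) c (code Phi) L o).
    apply covered_mono with (INR (cnt B (2 ^ t)) * (/ 2) ^ t)%R
      (fun X => exists o, o < 2 ^ t /\ B o /\ cyl (t, o) X); [| |apply covered_level].
    - apply half_weight_bound.
      assert (H : cnt (G t) (2 ^ t) + cnt B (2 ^ t) <= cnt (extends l w) (2 ^ t)).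
      { apply cnt_disj_le; unfold G, B; tauto. }
      pose proof (cnt_extends l w t Hlt).
      assert (H1 : 2 ^ l * (cnt (G t) (2 ^ t) + cnt B (2 ^ t)) <= 2 ^ l * 2 ^ (t - l))
        by (apply Nat.mul_le_mono_l; lia).
      rewrite <- Nat.pow_add_r in H1. replace (l + (t - l)) with t in H1 by lia. lia.
    - intros X [HX Ha]. exists (trunc X t).
      assert (extends l w (trunc X t))
        by (apply extends_of_cyl with t X; auto using cyl_trunc).
      split; [apply trunc_lt|]. split; [|apply cyl_trunc]. split; auto.
      intros Hg. apply Hno. exists X. unfold G. auto. }
  destruct Hex as (X & HX & _ & Hg). specialize (HX L HNL).
  unfold good_oracle in Hg. unfold accurate in HX. fold M in Hg, HX.
  (* Each late program is an error of [X] either at stage [t] or in the limit. *)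
  assert (Hle : cnt (fun y => S y < M /\ halts U y /\ ~ halts_by t (code U) y) M <=
    cnt (fun y => S y < M /\ ~ correct_by t (trunc X t) (code Phi) (code U) y) M +
    cnt (fun y => S y < M /\ ~ correct U Phi X y) M).
  { apply cnt_or_le. intros y _ (Hy & Hh & Hn).
    destruct (classic (correct_by t (trunc X t) (code Phi) (code U) y)) as [Hc|Hc];
      [right|left]; split; auto.
    now apply late_not_correct with t. }
  assert (2 ^ L <> 0) by (apply Nat.pow_nonzero; lia).
  lia.
Qed.

Lemma LimSup_lt_eventually u (e : R) :
  Rbar_lt (LimSup_seq u) (Finite e) -> exists N, forall n, N <= n -> (u n < e)%R.
Proof.
  unfold LimSup_seq. destruct (ex_LimSup_seq u) as [[r| |] H]; simpl; intros Hlt.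
  - assert (Hp : (0 < e - r)%R) by lra. destruct (H (mkposreal _ Hp)) as [_ [N HN]].
    exists N. intros n Hn. specialize (HN n Hn). simpl in HN. lra.
  - contradiction.
  - apply H.
Qed.

(** The origin of [eps]: there are fewer than [2 ^ (L + c + 1)] strings of length at most [L + c],
    and [(/ 2) ^ (c + 3)] times this bound is a quarter of [2 ^ L]. *)
Lemma accurate_of_eps U Phi c X alpha L :
  ocomputes Phi X alpha ->
  (eps_n alpha (dom U) (L + c) < (/ 2) ^ (c + 3))%R -> accurate U Phi c X L.
Proof.
  intros Hcomp He. unfold accurate.
  assert (Hcnt : cnt (fun y => S y < 2 ^ S (L + c) /\ ~ correct U Phi X y) (2 ^ S (L + c))
    <= count_P (err alpha (dom U)) (strs_upto (L + c))).
  { apply cnt_inj_le with (R := fun y w => enc w = y).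
    - intros y _ [Hy Hn]. destruct (enc_surj y) as [w <-]. exists w. split; auto. split.
      + apply in_strs_upto. pose proof (enc_length w) as [Hw _].
        apply Nat.lt_succ_r, (Nat.pow_lt_mono_r_iff 2); lia.
      + assert (Hdom : dom U w <-> halts U (enc w)).
        { split; [intros [x Hx]; now exists (enc x)|].
          intros [m Hm]. destruct (enc_surj m) as [x <-]. now exists x. }
        intros Hok. apply Hn. destruct (Hcomp w) as [Hnone Hval].
        assert (exists m, ocomp Phi X [enc w] m) as [m Hm].
        { apply NNPP. intros H. apply Hnone in H. rewrite H in Hok.
          destruct Hok as [[E _]|[E _]]; discriminate. }
        specialize (Hval m Hm). exists m. split; auto. rewrite Hdom, Hval in Hok.
        destruct (Nat.eqb_spec m 0) as [E0|E0]; simpl in Hok;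
          destruct Hok as [[E HU]|[E HU]]; try discriminate; auto.
    - intros i j w <- <-. reflexivity. }
  apply (Nat.mul_le_mono_l _ _ 4) in Hcnt. eapply Nat.le_trans; [exact Hcnt|].
  unfold eps_n in He. set (k := count_P _ _) in *.
  pose proof (length_strs_upto (L + c)) as Hlen.
  assert (HM : 0 < length (strs_upto (L + c))).
  { rewrite Nat.pow_succ_r' in Hlen.
    assert (2 ^ (L + c) <> 0) by (apply Nat.pow_nonzero; lia). lia. }
  apply lt_0_INR in HM. apply (f_equal INR) in Hlen. rewrite S_INR, pow_INR in Hlen.
  replace (INR 2) with 2%R in Hlen by reflexivity.
  apply Rmult_lt_compat_r with (1 := HM) in He.
  unfold Rdiv in He. rewrite Rmult_assoc, Rinv_l, Rmult_1_r in He by lra.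
  assert (Hpow : ((/ 2) ^ (c + 3) * 2 ^ S (L + c) * 4 = 2 ^ L)%R).
  { replace (S (L + c)) with (L + (c + 1)) by lia.
    rewrite pow_inv, !pow_add. field. apply pow_nonzero. lra. }
  assert (0 < (/ 2) ^ (c + 3))%R by (apply pow_lt; lra).
  apply INR_le. rewrite mult_INR, pow_INR. replace (INR 2) with 2%R by reflexivity.
  replace (INR 4) with 4%R by (simpl; lra). nra.
Qed.

Open Scope R_scope.

Theorem theorem5p3 (U : machine) (HU : optimal U) :
  exists eps : R, 0 < eps /\
    forall Phi : prf,
      ~ pos_prob (fun X => exists alpha : str -> option bool,
                    ocomputes Phi X alpha /\ Rbar_lt (Ebar alpha (dom U)) (Finite eps)).
Proof.
  destruct (search_machine _ (decid_good_for_program (code U))) as [V HV].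
  destruct (HU V) as [c Hc].
  exists ((/ 2) ^ (c + 3)). split; [apply pow_lt; lra|].
  intros Phi Hpos. apply Hpos. apply null_of_covered. intros d Hd.
  (* The upper limit gives a threshold [N] that varies with the oracle, so the event is split into
     countably many sets, one for each [N]. *)
  apply covered_mono with d
    (fun X => exists N, forall L, (N <= L)%nat -> accurate U Phi c X L); [lra| |].
  - intros X (alpha & Hcomp & Hlt).
    destruct (LimSup_lt_eventually _ _ Hlt) as [N HN].
    exists N. intros L HL. apply accurate_of_eps with alpha; auto.
    apply HN. lia.
  - apply covered_countable_union; auto. intros N e.
    now apply accurate_null with V.
Qed.
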